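(* For every $1\le p<2$ and every $K>0$ there is a constant $c(p,K)>0$, depending only on $p$ and $K$, such that the following holds. Let $(\Omega,\mu)$ be a probability space and let $f_1,\dots,f_N$ be a real orthonormal system in $L_2(\Omega)$ such that $\|f_k\|_\infty\le K$ for $k=1,\dots,N$. Then, for every integer $1\le n\le N/2$, $$ d_n(\{f_1,\dots,f_N\},L_p)\ \ge\ c(p,K)\min\{1,\,n^{-1/p}N^{1/2}\}. $$ Moreover, if $f_1,\dots,f_N$ is a complex orthonormal system in $L_2(\Omega)$ with $\|f_k\|_\infty\le K$ for all $k$, then the same lower bound holds for $d_n^{\mathbb C}(\{f_1,\dots,f_N\},L_p)$ for every integer $1\le n\le N/4$.
   Context: Here $L_p=L_p(\Omega,\mu)$. The Kolmogorov width is $$ d_n(\{f_1,\dots,f_N\},L_p):=\inf_{\dim V\le n}\ \max_{1\le k\le N}\operatorname{dist}_{L_p}(f_k,V), $$ where the infimum is over real linear subspaces $V$ of the real space $L_p$ of dimension at most $n$, and $\operatorname{dist}_{L_p}(f,V)=\inf_{g\in V}\|f-g\|_{L_p}$. The complex width $d_n^{\mathbb C}$ is defined in the same way with the complex space $L_p$ and complex linear subspaces $V$ with $\dim_{\mathbb C}V\le n$. *)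

(* Defs.v *)
From HB Require Import structures.
From mathcomp Require Import all_boot all_order all_algebra.
From mathcomp Require Import all_classical all_reals all_analysis.
From mathcomp Require Import complex.

Set Implicit Arguments.
Unset Strict Implicit.
Unset Printing Implicit Defensive.

Import Order.TTheory GRing.Theory Num.Theory.
Import numFieldNormedType.Exports.

Local Open Scope classical_set_scope.
Local Open Scope ring_scope.

(* Elements of L_p are represented by functions [T -> K].  A linear subspace of
   the space L of classes modulo a.e. equality is represented by its preimage,
   a set V of functions that is saturated for a.e. equality inside L, and its
   dimension is computed modulo a.e. equality.  The definitions are shared by
   the real (K = R) and complex (K = R[i]) spaces. *)
Section KolmogorovWidth.
Context {d : measure_display} {T : measurableType d} {R : realType}.
Context {K : fieldType}.
Variable mu : {measure set T -> \bar R}.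
Implicit Types (L V : set (T -> K)) (nrm : (T -> K) -> \bar R).

Definition linear_subspace L V : Prop :=
  [/\ V `<=` L,
      V (fun=> 0),
      forall (a : K) (g h : T -> K),
        V g -> V h -> V (fun x => a * g x + h x) &
      forall g h : T -> K,
        V g -> L h -> (\forall x \ae mu, g x = h x) -> V h].

Definition dim_at_most (n : nat) V : Prop :=
  exists b : 'I_n -> T -> K,
    (forall i, V (b i)) /\
    forall g, V g -> exists a : 'I_n -> K,
      \forall x \ae mu, g x = \sum_(i < n) a i * b i x.

Definition dist nrm (f : T -> K) V : \bar R :=
  ereal_inf [set nrm (fun x => f x - g x) | g in V].

Definition kolmogorov_width L nrm (n N : nat) (f : 'I_N -> T -> K) : \bar R :=
  ereal_inf [set \big[maxe/-oo%E]_(k < N) dist nrm (f k) V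
            | V in [set V | linear_subspace L V /\ dim_at_most n V]].

End KolmogorovWidth.

Section RealLp.
Context {d : measure_display} {T : measurableType d} {R : realType}.
Variable mu : {measure set T -> \bar R}.

Definition real_orthonormal (N : nat) (f : 'I_N -> T -> R) : Prop :=
  (forall k, f k \in Lfun mu 2%:E) /\
  forall j k, \int[mu]_x (f j x * f k x) = (j == k)%:R.

Definition real_width (p : R) (n N : nat) (f : 'I_N -> T -> R) : \bar R :=
  kolmogorov_width mu [set` Lfun mu p%:E]
    (fun g => 'N[mu]_p%:E[EFin \o g])%E n f.

End RealLp.

Section ComplexLp.
Context {d : measure_display} {T : measurableType d} {R : realType}.
Variable mu : {measure set T -> \bar R}.

Definition complex_Lnorm (p : \bar R) (f : T -> R[i]) : \bar R :=
  'N[mu]_p[EFin \o @Normc.normc R \o f]%E.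

Definition complex_Lfun (p : \bar R) : set (T -> R[i]) :=
  [set f | [/\ measurable_fun setT (fun x => complex.Re (f x)),
               measurable_fun setT (fun x => complex.Im (f x)) &
               (complex_Lnorm p f < +oo)%E]].

Definition complex_integral (f : T -> R[i]) : R[i] :=
  Complex (\int[mu]_x complex.Re (f x)) (\int[mu]_x complex.Im (f x)).

Definition complex_orthonormal (N : nat) (f : 'I_N -> T -> R[i]) : Prop :=
  (forall k, complex_Lfun 2%:E (f k)) /\
  forall j k, complex_integral (fun x => f j x * conjc (f k x)) = (j == k)%:R.

Definition complex_width (p : R) (n N : nat) (f : 'I_N -> T -> R[i]) : \bar R :=
  kolmogorov_width mu (complex_Lfun p%:E) (complex_Lnorm p%:E) n f.

End ComplexLp.

(* Main.v *)
Require Import Defs.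
From HB Require Import structures.
From mathcomp Require Import all_boot all_order all_algebra.
From mathcomp Require Import all_classical all_reals all_analysis.
From mathcomp Require Import perm complex.
From mathcomp Require Import measurable_realfun ess_sup_inf.
From mathcomp Require Import ring lra.

Set Implicit Arguments.
Unset Strict Implicit.
Unset Printing Implicit Defensive.

Import Order.TTheory GRing.Theory Num.Theory.
Import numFieldNormedType.Exports.

Local Open Scope classical_set_scope.
Local Open Scope ring_scope.

(* Let [V] be spanned by [b_1, ..., b_n], let [g_k] in [V] satisfy
   [\int |f_k - g_k|^p <= eps^p] and put [tau = n^(-1/p) N^(1/2)].

   Lewis' change of density gives a basis [phi] of [V] such that, with
   [q = \sum_i phi_i^2] and [w = q^(p/2-1)], the [phi_i] are orthonormal in
   [L_2(w mu)] and [\int q^(p/2) = n].  Write [g_k = \sum_i a_ki phi_i].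
   - Since [f_k] is bounded, [\int f_k g_k] is bounded below even after
     restriction to [{q <= L}] with [L^(p/2)] a large multiple of [n]; Bessel's
     inequality for the functions [phi_i 1_{q <= L}] then gives
     [N <~ (\sum_k |a_k|^2)^(1/2) n^(1/p)].
   - The map [r |-> (\int r phi_i w)_i] is bounded from [L_p] to [l_2] by an
     absolute constant (cut [r] at the level [|r| = eps q^(1/2)]) and returns
     [a_k] at [g_k]; with Bessel's inequality for the [phi_i w] this gives
     [\sum_k |a_k|^2 <~ n^(2-2/p) + N eps^2].
   Hence [N^2 <~ n^2 + N n^(2/p) eps^2], which is [eps >~ tau] unless [n] is
   comparable to [N].  In that remaining case, [(\int (f_k - g_k) f_j)_kj] is
   the identity minus a matrix of rank at most [n], so its squared Frobenius
   norm is at least [N - n >= N/2], and the same [L_p -> l_2] bound concludes. *)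

(** For [p < 2] the [phi_i] need only lie in L_p, so Bessel's inequality cannot be applied to them
    directly; the cut-off [q <= L] and the factor [w] both serve to produce L_2 functions. An exact
    Lewis basis would require a minimiser, hence compactness and linearly independent [b_i].
    Near-minimisers are used instead: they are orthonormal up to an entrywise error [1/(4n)], and
    [q] is enlarged by [delta^2] times the squared Frobenius norm of the transition matrix. Since
    [delta] is chosen after the coefficients of the [g_k] in the [b_i] are known, this costs at most
    [eps^2] per function and leaves no trace in the constants. Two arguments are needed because the
    term [n^2] carries a constant: the Lewis bound says nothing when [N] is below a fixed multiple
    of [n], whereas the Frobenius bound loses a power of [N/n], which is harmless exactly there. The
    complex case is the real case on two copies of the probability space. Complex dimension [n]
    becomes real dimension [2n], whence the condition [n <= N/4]. *)

(** * Integrals of real functions over a probability space *)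

Section RealIntegral.
Context {d : measure_display} {T : measurableType d} {R : realType}.
Variable mu : probability T R.
Implicit Types f g h : T -> R.

Definition integrableR f := mu.-integrable setT (EFin \o f).
Local Notation E f := (Rintegral mu setT f).

Lemma integrableR_measurable f : integrableR f -> measurable_fun setT f.
Proof. by move=> /integrableP[] /measurable_EFinP. Qed.

Lemma integrableR_le f g : measurable_fun setT f -> integrableR g ->
  (forall x, `|f x| <= g x) -> integrableR f.
Proof.
move=> mf ig le; apply: (le_integrable measurableT _ _ ig).
  exact/measurable_EFinP.
by move=> x _ /=; rewrite lee_fin (le_trans (le x)) ?ler_norm.
Qed.

Lemma integrableR_cst (c : R) : integrableR (fun=> c).
Proof.
by apply: (finite_measure_integrable_cst mu c).
Qed.

Lemma integrableRD f g : integrableR f -> integrableR g -> integrableR (fun x => f x + g x).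
Proof. by move=> ? ?; apply: (integrableD measurableT (f := EFin \o f) (g := EFin \o g)). Qed.

Lemma integrableRZ (c : R) f : integrableR f -> integrableR (fun x => c * f x).
Proof. by move=> ?; apply: (integrableZl measurableT c (f := EFin \o f)). Qed.

Lemma integrableR_sum (I : Type) (s : seq I) (F : I -> T -> R) :
  (forall i, integrableR (F i)) -> integrableR (fun x => \sum_(i <- s) F i x).
Proof.
move=> iF; elim: s => [|i s IH].
  by under eq_fun do rewrite big_nil; exact: integrableR_cst.
by under eq_fun do rewrite big_cons; exact: integrableRD.
Qed.

Lemma Rint_add f g : integrableR f -> integrableR g -> E (fun x => f x + g x) = E f + E g.
Proof. by move=> *; exact: RintegralD. Qed.

Lemma Rint_sub f g : integrableR f -> integrableR g -> E (fun x => f x - g x) = E f - E g.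
Proof. by move=> *; exact: RintegralB. Qed.

Lemma Rint_scale (c : R) f : integrableR f -> E (fun x => c * f x) = c * E f.
Proof. by move=> *; exact: RintegralZl. Qed.

Lemma Rint_cst (c : R) : E (fun=> c) = c.
Proof.
have -> : (fun=> c) = cst c by [].
by rewrite Rintegral_cst//= probability_setT mulr1.
Qed.

Lemma Rint_sum (I : Type) (s : seq I) (F : I -> T -> R) :
  (forall i, integrableR (F i)) -> E (fun x => \sum_(i <- s) F i x) = \sum_(i <- s) E (F i).
Proof.
move=> iF; elim: s => [|i s IH].
  by under eq_fun do rewrite big_nil; rewrite Rint_cst big_nil.
under eq_fun do rewrite big_cons.
by rewrite big_cons Rint_add ?IH//; exact: integrableR_sum.
Qed.

Lemma Rint_le f g : integrableR f -> integrableR g -> (forall x, f x <= g x) -> E f <= E g.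
Proof. by move=> *; exact: le_Rintegral. Qed.

Lemma Rint_ge0 f : (forall x, 0 <= f x) -> 0 <= E f.
Proof. by move=> *; exact: Rintegral_ge0. Qed.

End RealIntegral.

(** * Elementary inequalities for powers and logarithms *)

Section RealInequalities.
Context {R : realType}.
Implicit Types a p s t x y : R.

(** Concavity of the power, obtained without calculus: Young's inequality for [z^a * 1] gives
    [z^a <= a z + (1 - a)], used at [z = y / x]. *)
Lemma powR_tangent a x y : 0 < a < 1 -> 0 < x -> 0 <= y ->
  y `^ a <= x `^ a + a * x `^ (a - 1) * (y - x).
Proof.
move=> /andP[a0 a1] x0 y0.
have bern z : 0 <= z -> z `^ a <= a * z + (1 - a).
  move=> z0.
  have := @conjugate_powR R (z `^ a) 1 a^-1 (1 - a)^-1 (powR_ge0 _ _) ler01.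
  rewrite !invrK powR1 -powRrM mulfV ?gt_eqF// powRr1// mulr1 mul1r mulrC; apply.
  - by rewrite invr_gt0.
  - by rewrite invr_gt0 subr_gt0.
  - by rewrite addrCA subrr addr0.
have yx : y = x * (y / x) by rewrite mulrCA mulfV ?mulr1// gt_eqF.
have yx0 : 0 <= y / x by rewrite divr_ge0// ltW.
have xa : x `^ a = x * x `^ (a - 1).
  by rewrite mulr_powRB1// ltW.
rewrite {1}yx powRM//; last exact: ltW.
apply: (le_trans (ler_wpM2l (powR_ge0 _ _) (bern _ yx0))).
rewrite xa le_eqVlt; apply/orP; left; apply/eqP.
by field; rewrite gt_eqF.
Qed.

Lemma powRD_le a x y : 0 <= a -> 0 <= x -> 0 <= y ->
  (x + y) `^ a <= 2 `^ a * (x `^ a + y `^ a).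
Proof.
move=> a0 x0 y0; rewrite mulrDr -!powRM//.
case: (leP x y) => xy.
  apply: (@le_trans _ _ ((2 * y) `^ a)); last by rewrite lerDr powR_ge0.
  by apply: ge0_ler_powR; rewrite ?nnegrE; lra.
apply: (@le_trans _ _ ((2 * x) `^ a)); last by rewrite lerDl powR_ge0.
by apply: ge0_ler_powR; rewrite ?nnegrE; lra.
Qed.

(** Apply [ln (1 + u) <= u] to [1 + u = 1 / (1 + t)]: this gives [ln (1 + t) >= t / (1 + t)], which
    exceeds the left-hand side by [t^2 (1 + 2 t) / (1 + t)]. *)
Lemma ln1D_ge t : - 2^-1 <= t -> t - 2 * t ^+ 2 <= ln (1 + t).
Proof.
move=> t12; have t0 : 0 < 1 + t by lra.
have t1 : 1 + t != 0 by rewrite gt_eqF.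
have := @le_ln1Dx R ((1 + t)^-1 - 1).
rewrite ltrBrDl subrr invr_gt0 t0 addrCA subrr addr0 lnV ?posrE// => /(_ isT).
rewrite lerNl; apply: le_trans.
rewrite opprB -subr_ge0.
rewrite (_ : _ - _ = t ^+ 2 * (1 + 2 * t) / (1 + t)); last by field.
by rewrite divr_ge0 ?(ltW t0)// mulr_ge0 ?sqr_ge0//; lra.
Qed.

End RealInequalities.

(** * Row operations, determinants and the distance from the identity to low-rank matrices *)

Section Matrices.
Context {R : realType}.

(** The case [i = j] is allowed and scales row [i] by [1 + t], so these moves cover all the
    directions in which the Lewis functional is perturbed. *)
Definition add_row n (i j : 'I_n) (t : R) (A : 'M[R]_n) : 'M[R]_n :=
  \matrix_(k, l) (A k l + (k == i)%:R * (t * A j l)).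

Lemma det_add_row n (i j : 'I_n) (t : R) (A : 'M[R]_n) :
  \det (add_row i j t A) = (1 + t * (i == j)%:R) * \det A.
Proof.
pose C : 'M[R]_n := \matrix_(k, l) (if k == i then A j l else A k l).
rewrite (@determinant_multilinear _ _ _ A C i 1 t); last 3 first.
- by apply/rowP => l; rewrite !mxE eqxx !mul1r.
- by apply/matrixP => k l; rewrite !mxE eq_sym (negbTE (neq_lift _ _)) mul0r addr0.
- by apply/matrixP => k l; rewrite !mxE eq_sym (negbTE (neq_lift _ _)) mul0r addr0.
rewrite mulrDl -mulrA; congr (_ + _ * _).
have [ij|ij] := eqVneq i j.
  rewrite mul1r; congr (\det _); apply/matrixP => k l; rewrite mxE -ij.
  by case: eqVneq => [->|].
rewrite mul0r; apply: (determinant_alternate ij) => l; rewrite !mxE eqxx.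
by rewrite eq_sym (negbTE ij).
Qed.

Definition sqnorm_mx m n (A : 'M[R]_(m, n)) := \sum_i \sum_j A i j ^+ 2.

Lemma sqnorm_mx_ge0 m n (A : 'M[R]_(m, n)) : 0 <= sqnorm_mx A.
Proof. by apply: sumr_ge0 => i _; apply: sumr_ge0 => j _; exact: sqr_ge0. Qed.

Lemma entry_le_sqnorm_mx m n (A : 'M[R]_(m, n)) i j : A i j ^+ 2 <= sqnorm_mx A.
Proof.
rewrite /sqnorm_mx (bigD1 i)//= (bigD1 j)//= -addrA lerDl addr_ge0//.
  by apply: sumr_ge0 => *; exact: sqr_ge0.
by apply: sumr_ge0 => *; apply: sumr_ge0 => *; exact: sqr_ge0.
Qed.

(** A crude form of Hadamard's inequality, read off the Leibniz formula: each of the [n!] products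
    has factors bounded by the Frobenius norm. Only the degree in that norm matters later. *)
Lemma sqr_det_le n (A : 'M[R]_n) :
  (\det A) ^+ 2 <= (n`!%:R) ^+ 2 * sqnorm_mx A ^+ n.
Proof.
have le1 : `|\det A| <= n`!%:R * Num.sqrt (sqnorm_mx A) ^+ n.
  rewrite /determinant (le_trans (ler_norm_sum _ _ _))//.
  rewrite -[in leRHS](card_Sn n) -sum1_card natr_sum mulr_suml.
  rewrite [leRHS](eq_bigl xpredT); last by move=> s; rewrite inE.
  apply: ler_sum => s _; rewrite normrM normrX normrN1 expr1n !mul1r.
  rewrite normr_prod -[X in _ ^+ X]card_ord -prodr_const.
  apply: ler_prod => i _; rewrite normr_ge0 -sqrtr_sqr ler_sqrt//.
    exact: entry_le_sqnorm_mx.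
  exact: sqnorm_mx_ge0.
rewrite -[leLHS]real_normK ?num_real//.
rewrite -[X in X ^+ n]sqr_sqrtr ?sqnorm_mx_ge0// -exprM mulnC exprM -exprMn.
by rewrite lerXn2r ?nnegrE ?mulr_ge0 ?ler0n ?exprn_ge0 ?sqrtr_ge0.
Qed.

(* Gram-Schmidt, one vector at a time: if [e = d P] is nonzero, replace the
   projection [P] by [P - e^T e / (e e^T)]. *)
Lemma orthogonal_projection_ker N (s : seq 'rV[R]_N) :
  exists P : 'M[R]_N, [/\ P *m P = P, P^T = P,
    forall v, v \in s -> v *m P = 0 & N%:R - (size s)%:R <= \tr P].
Proof.
elim: s => [|v s [P [PP PT Ps trP]]].
  by exists 1%:M; split; rewrite ?mulmx1 ?trmx1 ?mxtrace1 ?subr0.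
have [e eE] : exists e, e = v *m P by exists (v *m P).
have [e0|e0] := eqVneq e 0.
  exists P; split=> // [w|].
    by rewrite inE => /predU1P[->|/Ps//]; rewrite -eE.
  by apply: le_trans trP; rewrite lerD2l lerN2 ler_nat /=.
pose r := (e *m e^T) 0 0.
have eeT : e *m e^T = r%:M by rewrite -mx11_scalar.
have r0 : r != 0.
  have -> : r = \sum_j e 0 j ^+ 2.
    by rewrite /r mxE; apply: eq_bigr => j _; rewrite [e^T _ _]mxE expr2.
  apply: contraNneq e0 => /eqP.
  rewrite psumr_eq0 => [/allP h|j _]; last exact: sqr_ge0.
  apply/eqP/rowP => j; rewrite [RHS]mxE.
  have := h j; rewrite mem_index_enum => /(_ isT).
  by rewrite sqrf_eq0 => /eqP.
have eP : e *m P = e by rewrite eE -mulmxA PP.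
have PeT : P *m e^T = e^T by rewrite -[in LHS]PT -trmx_mul eP.
exists (P - r^-1 *: (e^T *m e)); split.
- rewrite mulmxBl !mulmxBr PP -!scalemxAl -!scalemxAr -!mulmxA eP.
  rewrite [P *m (_ *m e)]mulmxA PeT [e *m (_ *m _)]mulmxA eeT mul_scalar_mx.
  rewrite -scalemxAr !scalerA mulVf// mulr1 subrr subr0 //.
- by rewrite linearB linearZ /= trmx_mul trmxK PT.
- move=> w; rewrite inE => /predU1P[->|ws].
    rewrite mulmxBr -scalemxAr mulmxA -eE.
    have -> : v *m e^T = r%:M.
      by rewrite -eeT -{1}PeT mulmxA -eE.
    by rewrite mul_scalar_mx scalerA mulVf// scale1r subrr.
  rewrite mulmxBr Ps// -scalemxAr mulmxA.
  have -> : w *m e^T = 0 by rewrite -PeT mulmxA Ps// mul0mx.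
  by rewrite mul0mx scaler0 subrr.
- rewrite linearB linearZ /= mxtrace_mulC eeT mxtrace_scalar mulr1n mulVf//.
  rewrite -natr1; apply: le_trans (lerB trP (lexx 1)).
  by rewrite opprD addrA.
Qed.

Lemma sqnorm_mx_trace m n (A : 'M[R]_(m, n)) : sqnorm_mx A = \tr (A^T *m A).
Proof.
rewrite /mxtrace /sqnorm_mx exchange_big; apply: eq_bigr => j _ /=.
by rewrite mxE; apply: eq_bigr => i _; rewrite mxE expr2.
Qed.

(** Let [P] project orthogonally onto the complement of the rows of [D]. Then [M = 1 - C D]
    satisfies [M P = P], so [tr P] is the Frobenius product of [M] and [P], hence at most half the
    sum of their squared norms; that of [P] is again [tr P], and [tr P >= N - n]. *)
Lemma sqnorm_id_sub_lowrank N n (C : 'M[R]_(N, n)) (D : 'M[R]_(n, N)) :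
  N%:R - n%:R <= sqnorm_mx (1%:M - C *m D).
Proof.
have [P [PP PT Ps trP]] := orthogonal_projection_ker [seq row i D | i : 'I_n].
rewrite size_map size_enum_ord in trP; apply: (le_trans trP).
have DP : D *m P = 0.
  apply/row_matrixP => i; rewrite row0 row_mul.
  by apply: Ps; apply: (map_f (fun i => row i D)); rewrite mem_enum.
set M := _ - _; have MP : M *m P = P.
  by rewrite /M mulmxBl mul1mx -mulmxA DP mulmx0 subr0.
have trMP : \tr P = \sum_i \sum_j M i j * P i j.
  rewrite -[in LHS]MP /mxtrace; apply: eq_bigr => i _.
  by rewrite [LHS]mxE; apply: eq_bigr => j _; rewrite -[in LHS]PT [P^T _ _]mxE.
have trPP : \tr P = sqnorm_mx P by rewrite sqnorm_mx_trace PT PP.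
suff : \tr P <= 2^-1 * (sqnorm_mx M + \tr P) by lra.
rewrite {2}trPP trMP /sqnorm_mx -big_split mulr_sumr /=.
apply: ler_sum => i _; rewrite -big_split mulr_sumr /=; apply: ler_sum => j _.
by have := sqr_ge0 (M i j - P i j); rewrite sqrrB; lra.
Qed.

End Matrices.

Lemma sqr_powR_half (R : realType) (p x : R) : (x ^+ 2) `^ (p / 2) = `|x| `^ p.
Proof.
rewrite -[x ^+ 2]real_normK ?num_real// -powR_mulrn// -powRrM.
by congr (_ `^ _); field.
Qed.

(** * Functions with integrable [p]-th power *)

Section Lp.
Context {d : measure_display} {T : measurableType d} {R : realType}.
Variables (mu : probability T R) (p : R).
Hypothesis p0 : 0 < p.

Definition inLp (f : T -> R) :=
  measurable_fun setT f /\ integrableR mu (fun x => `|f x| `^ p).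

Lemma measurable_normpowR (f : T -> R) (q : R) :
  measurable_fun setT f -> measurable_fun setT (fun x => `|f x| `^ q).
Proof.
move=> mf; apply: (measurableT_comp (measurable_powR q)).
exact: measurableT_comp.
Qed.

Lemma inLp_bounded (f : T -> R) (C : R) :
  measurable_fun setT f -> (forall x, `|f x| <= C) -> inLp f.
Proof.
move=> mf fC; split=> //; apply: (integrableR_le _ (integrableR_cst mu (C `^ p))).
  exact: measurable_normpowR.
move=> x; rewrite ger0_norm ?powR_ge0//.
by apply: ge0_ler_powR; rewrite ?nnegrE ?(ltW p0)// (le_trans _ (fC x)).
Qed.

Lemma inLpD (f g : T -> R) : inLp f -> inLp g -> inLp (fun x => f x + g x).
Proof.
move=> [mf If] [mg Ig]; split; first exact: measurable_funD.
apply: (integrableR_le _ (integrableRZ (2 `^ p) (integrableRD If Ig))).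
  exact/measurable_normpowR/measurable_funD.
move=> x; rewrite ger0_norm ?powR_ge0//.
apply: (le_trans _ (powRD_le _ _ _)); rewrite ?normr_ge0 ?(ltW p0)//.
by apply: ge0_ler_powR; rewrite ?nnegrE ?(ltW p0) ?addr_ge0 ?ler_normD.
Qed.

Lemma inLpZ (c : R) (f : T -> R) : inLp f -> inLp (fun x => c * f x).
Proof.
move=> [mf If]; split; first exact: measurable_funM.
rewrite (_ : (fun=> _) = fun x => `|c| `^ p * `|f x| `^ p).
  exact: integrableRZ.
by apply/funext => x; rewrite normrM powRM.
Qed.

Lemma inLp_sum (I : Type) (s : seq I) (F : I -> T -> R) :
  (forall i, inLp (F i)) -> inLp (fun x => \sum_(i <- s) F i x).
Proof.
move=> iF; elim: s => [|i s IH].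
  under eq_fun do rewrite big_nil.
  by apply: (@inLp_bounded _ 0) => // x; rewrite normr0.
by under eq_fun do rewrite big_cons; exact: inLpD.
Qed.

End Lp.

(** * The approximate Lewis change of density *)

Section Lewis.
Context {d : measure_display} {T : measurableType d} {R : realType}.
Variables (mu : probability T R) (p : R) (n : nat) (b : 'I_n -> T -> R) (delta : R).
Local Notation E f := (Rintegral mu setT f).

Definition lin (A : 'M[R]_n) i x := \sum_j A i j * b j x.
(* The term in [delta] keeps [reg] away from [0] and bounds [A] on the sublevel
   sets minimised below, even when the [b j] are linearly dependent. *)
Definition gram (A : 'M[R]_n) i k x :=
  lin A i x * lin A k x + delta ^+ 2 * \sum_l A i l * A k l.
Definition reg (A : 'M[R]_n) x := \sum_i gram A i i x.

Lemma gramii A i x :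
  gram A i i x = lin A i x ^+ 2 + delta ^+ 2 * \sum_l A i l ^+ 2.
Proof.
by rewrite /gram -expr2; congr (_ + _ * _); apply: eq_bigr => l _; rewrite expr2.
Qed.

Lemma gramii_ge0 A i x : 0 <= gram A i i x.
Proof.
rewrite gramii addr_ge0 ?sqr_ge0// mulr_ge0 ?sqr_ge0//.
by apply: sumr_ge0 => *; exact: sqr_ge0.
Qed.

Lemma lin_add_row i j t A k x :
  lin (add_row i j t A) k x = lin A k x + (k == i)%:R * (t * lin A j x).
Proof.
rewrite /lin !mulr_sumr -big_split; apply: eq_bigr => l _ /=.
by rewrite mxE; set e := (_ == _)%:R; ring.
Qed.

Lemma gram_add_row i j t A k x :
  gram (add_row i j t A) k k x =
  gram A k k x + (k == i)%:R * (2 * t * gram A i j x + t ^+ 2 * gram A j j x).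
Proof.
rewrite /gram lin_add_row.
have [->|ki] := eqVneq k i; last first.
  rewrite !mul0r !addr0; congr (_ + _ * _).
  by apply: eq_bigr => l _; rewrite !mxE (negbTE ki) !mul0r !addr0.
rewrite !mul1r.
have -> : \sum_l add_row i j t A i l * add_row i j t A i l =
  \sum_l A i l * A i l + 2 * t * (\sum_l A i l * A j l)
  + t ^+ 2 * (\sum_l A j l * A j l).
  rewrite !mulr_sumr -!big_split; apply: eq_bigr => l _ /=.
  by rewrite !mxE eqxx mul1r; ring.
ring.
Qed.

Lemma reg_add_row i j t A x :
  reg (add_row i j t A) x = reg A x + 2 * t * gram A i j x + t ^+ 2 * gram A j j x.
Proof.
rewrite /reg; under eq_bigr do rewrite gram_add_row.
rewrite big_split -addrA; congr (_ + _).
rewrite (bigD1 i)//= eqxx mul1r big1 ?addr0// => k /negbTE->.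
by rewrite mul0r.
Qed.

Lemma gramii_le_reg A i x : gram A i i x <= reg A x.
Proof.
by rewrite /reg (bigD1 i)//= lerDl sumr_ge0// => k _; exact: gramii_ge0.
Qed.

(** At each point [gram A] is the Gram matrix of the extended rows formed by [lin A i x] and the
    [delta * A i l]. Adding or subtracting row [k] leaves its diagonal nonnegative, which bounds the
    off-diagonal entries. *)
Lemma gram_le_reg A i k x : `|gram A i k x| <= reg A x.
Proof.
have h t : 0 <= gram A i i x + 2 * t * gram A i k x + t ^+ 2 * gram A k k x.
  have := gramii_ge0 (add_row i k t A) i x.
  by rewrite gram_add_row eqxx mul1r addrA.
have := h 1; have := h (-1).
have := gramii_le_reg A i x; have := gramii_le_reg A k x.
by rewrite ler_norml sqrrN expr1n => *; apply/andP; split; lra.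
Qed.

Lemma sum_lin_le_reg A x : \sum_i lin A i x ^+ 2 <= reg A x.
Proof.
apply: ler_sum => i _; rewrite gramii lerDl mulr_ge0 ?sqr_ge0//.
by apply: sumr_ge0 => *; exact: sqr_ge0.
Qed.

Lemma sqnorm_le_reg A x : delta ^+ 2 * sqnorm_mx A <= reg A x.
Proof.
rewrite /sqnorm_mx mulr_sumr; apply: ler_sum => i _.
by rewrite gramii lerDr sqr_ge0.
Qed.

Lemma sqnorm_mx_gt0 (A : 'M[R]_n) : (0 < n)%N -> \det A != 0 -> 0 < sqnorm_mx A.
Proof.
move=> n0 dA; rewrite lt_neqAle sqnorm_mx_ge0 andbT; apply: contraNneq dA => A0.
have := sqr_det_le A; rewrite -A0 expr0n gtn_eqF// mulr0 => h.
by rewrite -sqrf_eq0 eq_le h sqr_ge0.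
Qed.

Hypothesis delta0 : 0 < delta.
Hypothesis n0 : (0 < n)%N.

Lemma reg_gt0 A x : \det A != 0 -> 0 < reg A x.
Proof.
move=> dA; apply: lt_le_trans (sqnorm_le_reg A x).
by rewrite mulr_gt0 ?sqnorm_mx_gt0// exprn_gt0.
Qed.

Hypotheses (p0 : 0 < p) (p2 : p < 2).
Hypothesis Lb : forall i, inLp mu p (b i).

Lemma lin_inLp A i : inLp mu p (lin A i).
Proof. by apply: inLp_sum => // j; exact: inLpZ. Qed.

Lemma measurable_gram A i k : measurable_fun setT (gram A i k).
Proof.
have [mi _] := lin_inLp A i; have [mk _] := lin_inLp A k.
by apply: measurable_funD => //; exact: measurable_funM.
Qed.

Lemma measurable_reg A : measurable_fun setT (reg A).
Proof. by apply: measurable_sum => i; exact: measurable_gram. Qed.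

Lemma measurable_regpow A q : measurable_fun setT (fun x => reg A x `^ q).
Proof. exact: (measurableT_comp (measurable_powR q) (measurable_reg A)). Qed.

Lemma reg_ge0 A x : 0 <= reg A x.
Proof. by apply: sumr_ge0 => i _; exact: gramii_ge0. Qed.

Lemma integrableR_reg A : integrableR mu (fun x => reg A x `^ (p / 2)).
Proof.
(* [reg A] is a sum of squares of nonnegative terms, hence at most the square of their sum; [f] is a
   multiple-free majorant of its square root lying in L_p. *)
pose f x := \sum_i (`|lin A i x| + `|delta| * \sum_l `|A i l|).
have Lf : inLp mu p f.
  apply: inLp_sum => // i; apply: inLpD => //.
    have [m I] := lin_inLp A i; split; first exact: measurableT_comp.
    by under eq_fun do rewrite normr_id.
  by apply: (@inLp_bounded _ _ _ _ _ _ _ `| `|delta| * \sum_l `|A i l| |).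
case: Lf => mf If; apply: (integrableR_le (measurable_regpow _ _) If) => x.
rewrite ger0_norm ?powR_ge0// -sqr_powR_half.
apply: ge0_ler_powR; rewrite ?nnegrE ?sqr_ge0 ?reg_ge0 ?divr_ge0 ?(ltW p0)//.
have sq (I : finType) (F : I -> R) : (forall i, 0 <= F i) ->
    \sum_i F i ^+ 2 <= (\sum_i F i) ^+ 2.
  move=> F0; rewrite [leRHS]expr2 mulr_suml; apply: ler_sum => i _.
  rewrite expr2 ler_wpM2l// (bigD1 i)//= lerDl.
  by apply: sumr_ge0.
apply: (le_trans _ (sq _ _ _)); last first.
  move=> i; rewrite addr_ge0// mulr_ge0//.
  by apply: sumr_ge0.
apply: ler_sum => i _; rewrite gramii sqrrD -[lin A i x ^+ 2]real_normK ?num_real//.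
rewrite -addrA lerD2l exprMn real_normK ?num_real//.
have := sq _ (fun l => `|A i l|) (fun=> normr_ge0 _).
under eq_bigr do rewrite real_normK ?num_real//.
move=> /(ler_wpM2l (sqr_ge0 delta)) h; apply: (le_trans h).
rewrite lerDr mulrn_wge0// !mulr_ge0//.
by apply: sumr_ge0.
Qed.

Lemma regpowM A x : \det A != 0 -> reg A x `^ (p / 2 - 1) * reg A x = reg A x `^ (p / 2).
Proof. by move=> dA; rewrite mulrC mulr_powRB1 ?divr_gt0// ltW// reg_gt0. Qed.

Lemma integrableR_wgram A i k : \det A != 0 ->
  integrableR mu (fun x => reg A x `^ (p / 2 - 1) * gram A i k x).
Proof.
move=> dA; apply: (integrableR_le _ (integrableR_reg A)).
  by apply: measurable_funM; [exact: measurable_regpow|exact: measurable_gram].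
move=> x; rewrite normrM [`|_ `^ _|]ger0_norm ?powR_ge0// -regpowM//.
by rewrite ler_wpM2l ?powR_ge0// gram_le_reg.
Qed.

Let J A := E (fun x => reg A x `^ (p / 2)).
Let S A i k := E (fun x => reg A x `^ (p / 2 - 1) * gram A i k x).
(** Penalised form of Lewis' problem of maximising a determinant under a norm constraint. Formally,
    its derivative along [add_row i j t] at [t = 0] is [S A i j - (i == j)%:R], so stationarity
    means that the weighted Gram matrix [S A] is the identity. *)
Let Phi A := J A / p - ln `|\det A|.

(** This ties [J] to the dimension: when the diagonal of [S A] is close to 1, [J A] is close to
    [n]. *)
Lemma trace_S A : \det A != 0 -> \sum_i S A i i = J A.
Proof.
move=> dA; rewrite -Rint_sum; last by move=> i; exact: integrableR_wgram.
congr (Rintegral _ _ _); apply/funext => x.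
by rewrite -mulr_sumr regpowM.
Qed.

Lemma S_le_J A i k : \det A != 0 -> S A i k <= J A.
Proof.
move=> dA; apply: Rint_le; [exact: integrableR_wgram|exact: integrableR_reg|] => x.
rewrite -regpowM// ler_wpM2l ?powR_ge0//.
exact: le_trans (ler_norm _) (gram_le_reg _ _ _ _).
Qed.

(** As [p / 2 < 1], the power lies below its tangent, while [reg] is exactly quadratic in [t].
    Integrating the tangent inequality replaces differentiation under the integral. *)
Lemma J_add_row A i j t : \det A != 0 ->
  J (add_row i j t A) <= J A + p * t * S A i j + p / 2 * t ^+ 2 * S A j j.
Proof.
move=> dA; pose w x := reg A x `^ (p / 2 - 1).
pose g x := reg A x `^ (p / 2) + (p * t * (w x * gram A i j x)
   + p / 2 * t ^+ 2 * (w x * gram A j j x)).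
have I1 := integrableR_reg A; have I2 := integrableR_wgram i j dA.
have I3 := integrableR_wgram j j dA.
have I4 := integrableRD (integrableRZ (p * t) I2) (integrableRZ (p / 2 * t ^+ 2) I3).
have -> : J A + p * t * S A i j + p / 2 * t ^+ 2 * S A j j = E g.
  rewrite /g Rint_add// Rint_add; try exact: integrableRZ.
  by rewrite !Rint_scale// addrA.
apply: Rint_le => [||x]; [exact: integrableR_reg|exact: integrableRD|].
have := @powR_tangent R (p / 2) (reg A x) (reg (add_row i j t A) x).
rewrite reg_gt0// reg_ge0 ltr_pdivrMr ?ltr0n// mul1r p2 divr_gt0// => /(_ isT isT isT).
move=> h; apply: (le_trans h); rewrite reg_add_row /g lerD2l /w.
by rewrite le_eqVlt; apply/orP; left; apply/eqP; field.
Qed.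

(** The regularisation gives [J A >= z] with [z = (delta^2 |A|^2)^(p/2)], whereas [ln |det A|] is at
    most [(n / p) ln z] plus a constant. The linear term wins, by [ln y <= y - 1] at [y = z / n]. *)
Lemma Phi_lbound : exists C, forall A, \det A != 0 -> C <= Phi A.
Proof.
have nR : (0 : R) < n%:R by rewrite ltr0n.
exists (- ln n`!%:R + n%:R * ln (delta ^+ 2) / 2 + (n%:R - n%:R * ln n%:R) / p).
move=> A dA; set s := delta ^+ 2 * sqnorm_mx A.
have s0 : 0 < s by rewrite mulr_gt0 ?exprn_gt0 ?sqnorm_mx_gt0.
have Jz : s `^ (p / 2) <= J A.
  rewrite -(Rint_cst mu (s `^ _)); apply: Rint_le; [exact: integrableR_cst|exact: integrableR_reg|].
  move=> x; apply: ge0_ler_powR; rewrite ?nnegrE ?reg_ge0 ?(ltW s0)//.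
    by rewrite divr_ge0// ltW.
  exact: sqnorm_le_reg.
set z := s `^ (p / 2) in Jz.
have z0 : 0 < z by exact: powR_gt0.
have lnz : ln z = p / 2 * ln s by rewrite ln_powR.
have lnz' : ln z <= z / n%:R - 1 + ln n%:R.
  rewrite -lerBlDr -ln_div ?posrE// -[X in ln X](addrNK 1) addrC.
  apply: le_ln1Dx; rewrite ltrBrDl subrr divr_gt0//.
have lns : ln s = ln (delta ^+ 2) + ln (sqnorm_mx A).
  by rewrite lnM// posrE ?exprn_gt0 ?sqnorm_mx_gt0.
have fac0 : (0 : R) < n`!%:R by rewrite ltr0n fact_gt0.
have ld : ln `|\det A| <= ln n`!%:R + n%:R / 2 * ln (sqnorm_mx A).
  have : ln (`|\det A| ^+ 2) <= ln ((n`!%:R) ^+ 2 * sqnorm_mx A ^+ n).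
    have d0 : 0 < `|\det A| ^+ 2 by rewrite exprn_gt0 ?normr_gt0.
    rewrite ler_ln ?posrE//; first by rewrite real_normK ?num_real// sqr_det_le.
    by rewrite mulr_gt0 ?exprn_gt0 ?sqnorm_mx_gt0.
  rewrite lnM ?posrE ?exprn_gt0 ?sqnorm_mx_gt0// !lnXn ?normr_gt0 ?sqnorm_mx_gt0//.
  by rewrite -![ln _ *+ _]mulr_natl; lra.
apply: (@le_trans _ _ (z / p - ln `|\det A|)); last first.
  by rewrite /Phi lerD2r ler_pM2r ?invr_gt0.
have pinv : 0 < p^-1 by rewrite invr_gt0.
have key : n%:R * ln s / 2 <= (z - n%:R + n%:R * ln n%:R) / p.
  have -> : n%:R * ln s / 2 = n%:R * ln z / p.
    by rewrite lnz; field; rewrite gt_eqF.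
  rewrite ler_pM2r//.
  have := ler_wpM2l (ltW nR) lnz'.
  rewrite mulrDr mulrBr mulr1 mulrCA mulfV ?mulr1// gt_eqF//.
rewrite lns in key.
have -> : (n%:R - n%:R * ln n%:R) / p = z / p - (z - n%:R + n%:R * ln n%:R) / p.
  by field; rewrite gt_eqF.
move: key ld; set u := (_ + _) / p; set v := ln (sqnorm_mx A).
set w := ln (delta ^+ 2); set y := ln _`!%:R; set y' := ln _ .
lra.
Qed.

(* Near-minimisers of [Phi] satisfy the Lewis condition approximately: [Phi]
   can decrease only a little under the row operations [add_row i j (+- s)]. *)
Lemma approximate_lewis (eta : R) : 0 < eta ->
  exists A, [/\ \det A != 0, E (fun x => reg A x `^ (p / 2)) <= 2 * n%:R &
    forall i k, `|E (fun x => reg A x `^ (p / 2 - 1) * gram A i k x) - (i == k)%:R|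
      <= eta].
Proof.
have arith (J1 J0 l1 l0 m u e : R) : J0 - l0 < m + e -> J1 <= J0 + u ->
  m <= J1 - (l1 + l0) -> l1 - e <= u by lra.
move=> eta0.
have nR : (1 : R) <= n%:R by rewrite ler1n.
(* [s] is the size of the row operations and [s ^+ 2] the gap to the infimum. After division by [s],
   the gap, the error in [ln1D_ge] and the second-order term cost at most [(3 + n) s <= eta]; the
   bound [s n <= 1/8] serves to control [J A]. *)
pose s := Num.min ((8 * n%:R)^-1) (eta / (3 + n%:R)).
have s0 : 0 < s by rewrite lt_min !(divr_gt0, invr_gt0, mulr_gt0)//; lra.
have sn : s * n%:R <= 8^-1.
  have : s <= (8 * n%:R)^-1 by rewrite ge_min lexx.
  by rewrite -ler_pdivlMr ?(lt_le_trans ltr01)// invfM.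
have seta : s * (3 + n%:R) <= eta.
  have : s <= eta / (3 + n%:R) by rewrite ge_min lexx orbT.
  by rewrite ler_pdivlMr//; lra.
have s8 : s <= 8^-1 by apply: le_trans sn; rewrite ler_peMr// ltW.
have [C PhiC] := Phi_lbound.
pose X : set R := [set Phi A | A in [set A | \det A != 0]].
have lbX : has_lbound X by exists C => _ [A dA <-]; exact: PhiC.
have infX : has_inf X.
  by split=> //; exists (Phi 1%:M), 1%:M => //=; rewrite det1 oner_neq0.
have [_ [A dA <-] PhiA] := inf_adherent (exprn_gt0 2 s0) infX.
(* The first-order condition as a finite difference: a row operation cannot lower [Phi] by more than
   [s ^+ 2]. *)
have step i j t : 0 < 1 + t * (i == j)%:R ->
  ln (1 + t * (i == j)%:R) - s ^+ 2 <= t * S A i j + t ^+ 2 / 2 * S A j j.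
  move=> t0; have dA' : \det (add_row i j t A) != 0.
    by rewrite det_add_row mulf_neq0// gt_eqF.
  have : inf X <= Phi (add_row i j t A) by apply: ge_inf => //; exists (add_row i j t A).
  have := J_add_row i j t dA; rewrite -(ler_pM2r (x := p^-1)) ?invr_gt0//.
  rewrite /Phi det_add_row normrM [`|1 + _|]gtr0_norm// lnM ?posrE ?normr_gt0//.
  rewrite !mulrDl.
  have -> : p * t * S A i j / p = t * S A i j by field; rewrite gt_eqF.
  have -> : p / 2 * t ^+ 2 * S A j j / p = t ^+ 2 / 2 * S A j j.
    by field; rewrite gt_eqF.
  rewrite -addrA => h1 h2.
  exact: arith PhiA h1 h2.
have hi i : S A i i <= 1 + 3 * s + s / 2 * J A.
  have := step i i (- s); rewrite eqxx mulr1 => /(_ ltac:(lra)).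
  have := @ln1D_ge R (- s) ltac:(lra); have := S_le_J i i dA.
  rewrite sqrrN => SJ l1 l2.
  have : s * S A i i <= s * (1 + 3 * s + s / 2 * J A).
    have : s ^+ 2 / 2 * S A i i <= s ^+ 2 / 2 * J A.
      by rewrite ler_wpM2l// divr_ge0// sqr_ge0.
    lra.
  by rewrite ler_pM2l.
(* Summing the diagonal bounds yields [J <= n + 3 s n + (s n / 2) J], where [s n <= 1/8] lets the
   last term be absorbed. *)
have J2 : J A <= 2 * n%:R.
  have : \sum_i S A i i <= \sum_(i < n) (1 + 3 * s + s / 2 * J A) by apply: ler_sum.
  rewrite trace_S// sumr_const card_ord -mulr_natl.
  have J0 : 0 <= J A by apply: Rint_ge0 => x; exact: powR_ge0.
  have := ler_wpM2r J0 sn; lra.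
exists A; split=> // i k; rewrite -/(S A i k) ler_norml.
have SJ := S_le_J k k dA.
have SJs : s / 2 * S A k k <= s * n%:R.
  have : s / 2 * S A k k <= s / 2 * (2 * n%:R).
    by rewrite ler_wpM2l ?divr_ge0 ?(ltW s0)// (le_trans SJ).
  lra.
have div_s u v : s * u <= s * v -> u <= v by rewrite ler_pM2l.
have [ik|ik] := eqVneq i k.
  subst k; rewrite /=; apply/andP; split; last first.
    have := hi i; have := ler_wpM2l (ltW s0) J2; lra.
  have := step i i s; rewrite eqxx mulr1 => /(_ ltac:(lra)).
  have := @ln1D_ge R s ltac:(lra) => l1 l2.
  have : 1 - 3 * s - s / 2 * S A i i <= S A i i by apply: div_s; lra.
  lra.
(* Off the diagonal the determinant does not change, so the two signs of [t] bound [S A i k] from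
   both sides. *)
have := step i k s; have := step i k (- s).
rewrite (negbTE ik) !mulr0 addr0 ln1 sqrrN => /(_ ltr01) l1 /(_ ltr01) l2.
have u1 : S A i k <= s + s / 2 * S A k k by apply: div_s; lra.
have u2 : - S A i k <= s + s / 2 * S A k k by apply: div_s; lra.
by apply/andP; split; rewrite /= subr0; lra.
Qed.

End Lewis.

Lemma cauchy_schwarz_sum (R : realFieldType) (I : Type) (s : seq I) (u v : I -> R) :
  (\sum_(i <- s) u i * v i) ^+ 2 <= (\sum_(i <- s) u i ^+ 2) * (\sum_(i <- s) v i ^+ 2).
Proof.
set X := \sum_(i <- s) _; set U := (X in X * _); set V := (X in _ * X).
have h t : 0 <= U - 2 * t * X + t ^+ 2 * V.
  have : 0 <= \sum_(i <- s) (u i - t * v i) ^+ 2 by apply: sumr_ge0 => *; exact: sqr_ge0.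
  congr (_ <= _); rewrite /U /X /V !mulr_sumr -sumrB -big_split.
  by apply: eq_bigr => i _ /=; ring.
have U0 : 0 <= U by apply: sumr_ge0 => *; exact: sqr_ge0.
have : 0 <= V by apply: sumr_ge0 => *; exact: sqr_ge0.
rewrite le_eqVlt => /predU1P[V0|V0]; last first.
  have := h (X / V); rewrite -(pmulr_lge0 _ V0).
  have -> : (U - 2 * (X / V) * X + (X / V) ^+ 2 * V) * V = U * V - X ^+ 2.
    by field; rewrite gt_eqF.
  by rewrite subr_ge0.
rewrite -V0 mulr0 in h *.
have [->|X0] := eqVneq X 0; first by rewrite expr0n.
have := h ((U + 1) / (2 * X)); rewrite mulr0 addr0.
have -> : U - 2 * ((U + 1) / (2 * X)) * X = - 1 by field.
by rewrite oppr_ge0 ler10.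
Qed.

(** * The weighted pairing as a bounded map from L_p to l_2 *)

Section Pointwise.
Context {R : realType}.
Variable p : R.
Hypotheses (p1 : 1 <= p) (p2 : p < 2).

Lemma powRD_gt0 (x r s : R) : 0 < x -> x `^ (r + s) = x `^ r * x `^ s.
Proof. by move=> x0; rewrite powRD// (gt_eqF x0) implybT. Qed.

Lemma powR_half_sub1 (q : R) : 0 <= q -> q `^ (p / 2 - 1) = Num.sqrt q `^ (p - 2).
Proof.
by move=> q0; rewrite -powR12_sqrt// -powRrM; congr (_ `^ _); field.
Qed.

(** Here [u] stands for the square root of the density. If [|r| <= eps u], use
    [r y <= r^2 + y^2 / 4] and [r^2 u^(p-2) <= eps^(2-p) |r|^p]. Otherwise use [|y| u^(p-2) <= V
    u^(p-1) <= V (|r| / eps)^(p-1)], which is where [1 <= p] enters. *)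
Lemma pair_weight_le (V eps u r y : R) : 0 <= V -> 0 < eps -> 0 < u -> `|y| <= V * u ->
  r * y * u `^ (p - 2) <=
  (eps `^ (2 - p) + V * eps `^ (1 - p)) * `|r| `^ p + 4^-1 * (y ^+ 2 * u `^ (p - 2)).
Proof.
move=> V0 e0 u0 yV; set w := u `^ (p - 2).
have w0 : 0 <= w by exact: powR_ge0.
have rp0 : 0 <= `|r| `^ p by exact: powR_ge0.
have A0 : 0 <= eps `^ (2 - p) * `|r| `^ p by rewrite mulr_ge0 ?powR_ge0.
have B0 : 0 <= V * eps `^ (1 - p) * `|r| `^ p by rewrite !mulr_ge0 ?powR_ge0.
have C0 : 0 <= 4^-1 * (y ^+ 2 * w) by rewrite mulr_ge0 ?invr_ge0// mulr_ge0 ?sqr_ge0.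
rewrite mulrDl.
have [small|large] := leP `|r| (eps * u).
  have h1 : r * y * w <= r ^+ 2 * w + 4^-1 * (y ^+ 2 * w).
    have := mulr_ge0 (sqr_ge0 (r - y / 2)) w0.
    have -> : (r - y / 2) ^+ 2 * w = r ^+ 2 * w + 4^-1 * (y ^+ 2 * w) - r * y * w.
      by field.
    by rewrite subr_ge0.
  have h2 : r ^+ 2 * w <= eps `^ (2 - p) * `|r| `^ p.
    have [->|r0] := eqVneq r 0; first by rewrite expr0n/= mul0r mulr_ge0 ?powR_ge0.
    have r0' : 0 < `|r| by rewrite normr_gt0.
    rewrite -[r ^+ 2]real_normK ?num_real//.
    rewrite (_ : `|r| ^+ 2 = `|r| `^ (2 - p) * `|r| `^ p); last first.
      rewrite -powRD_gt0// -powR_mulrn//.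
      by congr (_ `^ _); ring.
    rewrite mulrAC ler_wpM2r//.
    rewrite [leRHS](_ : _ = (eps * u) `^ (2 - p) * w).
      rewrite ler_wpM2r// ge0_ler_powR// ?nnegrE ?subr_ge0 ?(ltW p2)//.
      by rewrite mulr_ge0 ?(ltW e0) ?(ltW u0).
    rewrite powRM ?(ltW e0) ?(ltW u0)// -mulrA /w -powRD_gt0//.
    by rewrite addrA subrK subrr powRr0 mulr1.
  by apply: (le_trans h1); lra.
have h : r * y * w <= V * eps `^ (1 - p) * `|r| `^ p.
  apply: (@le_trans _ _ (`|r| * (V * u) * w)).
    rewrite ler_wpM2r// (le_trans (ler_norm _))// normrM ler_wpM2l//.
  rewrite (_ : _ * w = V * (`|r| * (u * w))); last by ring.
  rewrite -mulrA ler_wpM2l//.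
  have r0 : 0 < `|r| by apply: lt_trans large; rewrite mulr_gt0.
  have -> : u * w = u `^ (p - 1).
    rewrite /w -{1}[u]powRr1 ?(ltW u0)// -powRD_gt0//.
    by congr (_ `^ _); ring.
  have -> : `|r| `^ p = `|r| * `|r| `^ (p - 1).
    by rewrite mulr_powRB1// (lt_le_trans ltr01).
  rewrite mulrCA ler_wpM2l//.
  have -> : eps `^ (1 - p) * `|r| `^ (p - 1) = (`|r| / eps) `^ (p - 1).
    rewrite powRM ?invr_ge0 ?(ltW e0)// mulrC; congr (_ * _).
    by rewrite -powR_inv1 ?(ltW e0)// -powRrM; congr (_ `^ _); ring.
  apply: ge0_ler_powR; rewrite ?nnegrE ?subr_ge0 ?(ltW u0) ?divr_ge0 ?(ltW e0)//.
  by rewrite ler_pdivlMr// mulrC ltW.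
by apply: (le_trans h); lra.
Qed.

End Pointwise.

Section DualBound.
Context {d : measure_display} {T : measurableType d} {R : realType}.
Variables (mu : probability T R) (p : R).
Hypotheses (p1 : 1 <= p) (p2 : p < 2).
Local Notation E f := (Rintegral mu setT f).

Let p20 : 0 < p / 2.
Proof. by rewrite divr_gt0// (lt_le_trans ltr01). Qed.

Lemma integrableR_pair_weight (r phi q : T -> R) :
  measurable_fun setT phi -> measurable_fun setT q ->
  integrableR mu (fun x => q x `^ (p / 2)) -> inLp mu p r ->
  (forall x, 0 < q x) -> (forall x, phi x ^+ 2 <= q x) ->
  integrableR mu (fun x => r x * phi x * q x `^ (p / 2 - 1)).
Proof.
move=> mphi mq Iq [mr Ir] q0 phiq.
apply: (integrableR_le _ (integrableRD (integrableRZ (1 + 1) Ir) (integrableRZ 4^-1 Iq))).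
  apply: measurable_funM; first exact: measurable_funM.
  exact: (measurableT_comp (measurable_powR _)).
move=> x; have u0 : 0 < Num.sqrt (q x) by rewrite sqrtr_gt0.
have := @pair_weight_le R p p1 p2 1 1 (Num.sqrt (q x)) `|r x| `|phi x| ler01 ltr01 u0.
rewrite !powR1 !mul1r !normr_id -powR_half_sub1 ?(ltW (q0 x))// !normrM.
rewrite [`|_ `^ _|]ger0_norm ?powR_ge0// -sqrtr_sqr ler_wsqrtr// => /(_ isT) h.
apply: (le_trans h); rewrite lerD2l ler_wpM2l//.
rewrite sqr_sqrtr ?sqr_ge0// -(mulr_powRB1 (ltW (q0 x)) p20).
by rewrite ler_wpM2r ?powR_ge0.
Qed.

(** Duality with the extremal vector: take [v] to be the vector of pairings itself, of norm [V], and
    [y = \sum_i v i * phi i]. Then [V^2] is the pairing of [r] with [y], and [|y| <= V q^(1/2)] by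
    Cauchy-Schwarz. Integrating [pair_weight_le] gives [V^2 <= eps^2 + V eps + V^2 / 2], hence
    [V <= 3 eps]. *)
Lemma dual_bound m (r q : T -> R) (phi : 'I_m -> T -> R) (eps : R) : 0 < eps ->
  inLp mu p r -> E (fun x => `|r x| `^ p) <= eps `^ p ->
  (forall i, measurable_fun setT (phi i)) -> measurable_fun setT q ->
  integrableR mu (fun x => q x `^ (p / 2)) -> (forall x, 0 < q x) ->
  (forall x, \sum_i phi i x ^+ 2 <= q x) ->
  (forall v : 'I_m -> R, E (fun x => (\sum_i v i * phi i x) ^+ 2 * q x `^ (p / 2 - 1))
     <= 2 * \sum_i v i ^+ 2) ->
  \sum_i (E (fun x => r x * phi i x * q x `^ (p / 2 - 1))) ^+ 2 <= 9 * eps ^+ 2.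
Proof.
move=> e0 Lr re mphi mq Iq q0 phiq G.
pose w x := q x `^ (p / 2 - 1).
have phiq1 i x : phi i x ^+ 2 <= q x.
  apply: le_trans (phiq x); rewrite (bigD1 i)//= lerDl.
  by apply: sumr_ge0 => *; exact: sqr_ge0.
have I1 i := integrableR_pair_weight (mphi i) mq Iq Lr q0 (phiq1 i).
pose v i := E (fun x => r x * phi i x * w x).
pose y x := \sum_i v i * phi i x.
set V2 := \sum_i _; have V20 : 0 <= V2 by apply: sumr_ge0 => *; exact: sqr_ge0.
pose V := Num.sqrt V2; have V0 : 0 <= V by exact: sqrtr_ge0.
have VV : V ^+ 2 = V2 by rewrite sqr_sqrtr.
have yV x : `|y x| <= V * Num.sqrt (q x).
  rewrite /V -sqrtrM// -sqrtr_sqr ler_wsqrtr//.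
  apply: (le_trans (cauchy_schwarz_sum _ _ _)).
  by rewrite ler_wpM2l.
have my : measurable_fun setT y.
  by apply: measurable_sum => i; exact: measurable_funM.
have mw : measurable_fun setT w by exact: (measurableT_comp (measurable_powR _)).
have Iy : integrableR mu (fun x => y x ^+ 2 * w x).
  apply: (integrableR_le _ (integrableRZ V2 Iq)).
    by apply: measurable_funM => //; exact: measurable_funX.
  move=> x; rewrite ger0_norm; last by rewrite mulr_ge0 ?sqr_ge0 ?powR_ge0.
  rewrite -(mulr_powRB1 (ltW (q0 x)) p20).
  rewrite mulrA ler_wpM2r ?powR_ge0//.
  rewrite -VV -[q x]sqr_sqrtr ?(ltW (q0 x))// -exprMn -real_normK ?num_real//.
  by rewrite lerXn2r// nnegrE// mulr_ge0// sqrtr_ge0.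
have V2E : V2 = E (fun x => r x * y x * w x).
  transitivity (E (fun x => \sum_i v i * (r x * phi i x * w x))).
    rewrite Rint_sum; last by move=> i; exact: integrableRZ.
    by apply: eq_bigr => i _; rewrite Rint_scale// expr2.
  congr (Rintegral _ _ _); apply/funext => x; rewrite /y mulr_sumr mulr_suml.
  by apply: eq_bigr => i _; ring.
have : V2 <= eps ^+ 2 + V * eps + V2 / 2.
  have Iryw : integrableR mu (fun x => r x * y x * w x).
    rewrite (_ : (fun=> _) = (fun x => \sum_i v i * (r x * phi i x * w x))).
      by apply: integrableR_sum => i; exact: integrableRZ.
    apply/funext => x; rewrite /y mulr_sumr mulr_suml.
    by apply: eq_bigr => i _; ring.
  pose c := eps `^ (2 - p) + V * eps `^ (1 - p).
  have c0 : 0 <= c by rewrite addr_ge0 ?mulr_ge0 ?powR_ge0.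
  have := G v; rewrite -/V2 => Gv.
  have le1 : V2 <= c * E (fun x => `|r x| `^ p) + 4^-1 * E (fun x => y x ^+ 2 * w x).
    case: Lr => mr Ir.
    rewrite -!Rint_scale// -Rint_add; [|exact: integrableRZ..].
    rewrite V2E; apply: Rint_le => // [|x]; first by apply: integrableRD; exact: integrableRZ.
    rewrite /w powR_half_sub1 ?(ltW (q0 x))//.
    by apply: pair_weight_le; rewrite ?sqrtr_gt0.
  apply: (le_trans le1).
  have cE : c * eps `^ p = eps ^+ 2 + V * eps.
    rewrite /c mulrDl -mulrA -!powRD_gt0//.
    rewrite !subrK powRr1 ?(ltW e0)//; congr (_ + _).
    by rewrite -powR_mulrn ?ltW.
  have := ler_wpM2l c0 re; rewrite cE => h2.
  have : 4^-1 * E (fun x => y x ^+ 2 * w x) <= V2 / 2.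
    by apply: (@le_trans _ _ (4^-1 * (2 * V2))); [exact: ler_wpM2l|lra].
  lra.
rewrite -VV => h.
have V3 : V <= 3 * eps.
  rewrite leNgt; apply/negP => Ve.
  have : V * (3 * eps) < V * V by rewrite ltr_pM2l//; lra.
  have : eps * (3 * eps) < V * eps by rewrite mulrC ltr_pM2r.
  have : 0 < eps * eps by rewrite mulr_gt0.
  by move: h; rewrite !expr2; lra.
have -> : 9 * eps ^+ 2 = (3 * eps) ^+ 2 by ring.
by rewrite lerXn2r// nnegrE//; lra.
Qed.

End DualBound.

(** * Bessel's inequality for a bounded orthonormal system *)

Section Bessel.
Context {d : measure_display} {T : measurableType d} {R : realType}.
Variables (mu : probability T R) (K : R) (N : nat) (f : 'I_N -> T -> R).
Local Notation E f := (Rintegral mu setT f).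
Hypothesis mf : forall k, measurable_fun setT (f k).
Hypothesis fK : forall k x, `|f k x| <= K.
Hypothesis of_ : forall j k, E (fun x => f j x * f k x) = (j == k)%:R.

Lemma integrableR_mul_bounded (h g : T -> R) : measurable_fun setT h ->
  (forall x, `|h x| <= K) -> integrableR mu g -> integrableR mu (fun x => h x * g x).
Proof.
move=> mh hK Ig; have mg := integrableR_measurable Ig.
have Ig' : integrableR mu (fun x => `|g x|).
  exact: integrable_norm Ig.
apply: (integrableR_le _ (integrableRZ K Ig')); first exact: measurable_funM.
by move=> x; rewrite normrM ler_wpM2r.
Qed.

Lemma integrableR_bounded_orthonormal j k : integrableR mu (fun x => f j x * f k x).
Proof.
apply: integrableR_mul_bounded => //; apply: (integrableR_le (mf k) (integrableR_cst mu K)).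
exact: fK.
Qed.

Lemma integrableR_sqr (g : T -> R) : measurable_fun setT g -> integrableR mu (fun x => g x ^+ 2) ->
  integrableR mu g.
Proof.
move=> mg Ig; apply: (integrableR_le mg (integrableRD (integrableR_cst mu 1) Ig)) => x.
have := sqr_ge0 (`|g x| - 1); rewrite sqrrB real_normK ?num_real//.
have := sqr_ge0 (g x); lra.
Qed.

Lemma bessel (g : T -> R) : measurable_fun setT g -> integrableR mu (fun x => g x ^+ 2) ->
  \sum_k (E (fun x => f k x * g x)) ^+ 2 <= E (fun x => g x ^+ 2).
Proof.
move=> mg Ig2; have Ig := integrableR_sqr mg Ig2.
have Ifg k := integrableR_mul_bounded (mf k) (fK k) Ig.
pose c k := E (fun x => f k x * g x).
have I1 k : integrableR mu (fun x => c k * (f k x * g x)) by exact: integrableRZ.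
have I2 j k : integrableR mu (fun x => c j * c k * (f j x * f k x)).
  by apply: integrableRZ; exact: integrableR_bounded_orthonormal.
have : 0 <= E (fun x => (g x - \sum_k c k * f k x) ^+ 2).
  by apply: Rint_ge0 => x; exact: sqr_ge0.
rewrite (_ : (fun x => (_ - _) ^+ 2) = fun x =>
   g x ^+ 2 + (- 2 * (\sum_k c k * (f k x * g x)) +
   \sum_j \sum_k c j * c k * (f j x * f k x))); last first.
  apply/funext => x; rewrite sqrrB -addrA mulNr -mulr_natl mulr_sumr; congr (_ + (- _ + _)).
    by rewrite !mulr_sumr; apply: eq_bigr => k _; ring.
  rewrite expr2 mulr_suml; apply: eq_bigr => j _.
  by rewrite mulr_sumr; apply: eq_bigr => k _; ring.
have I3 : integrableR mu (fun x => \sum_k c k * (f k x * g x)) by apply: integrableR_sum.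
have I4 j : integrableR mu (fun x => \sum_k c j * c k * (f j x * f k x)) by apply: integrableR_sum.
have I5 : integrableR mu (fun x => \sum_j \sum_k c j * c k * (f j x * f k x)).
  by apply: integrableR_sum.
rewrite Rint_add//; last by apply: integrableRD => //; exact: integrableRZ.
rewrite Rint_add//; last exact: integrableRZ.
rewrite Rint_scale// Rint_sum// Rint_sum//.
have -> : \sum_k E (fun x => c k * (f k x * g x)) = \sum_k c k ^+ 2.
  by apply: eq_bigr => k _; rewrite Rint_scale// expr2.
have -> : \sum_j E (fun x => \sum_k c j * c k * (f j x * f k x)) = \sum_k c k ^+ 2.
  apply: eq_bigr => j _; rewrite Rint_sum// (bigD1 j)//= big1 => [|k kj].
    by rewrite Rint_scale ?of_ ?eqxx ?mulr1 ?addr0 ?expr2//; exact: integrableR_bounded_orthonormal.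
  by rewrite Rint_scale ?of_ 1?eq_sym ?(negbTE kj) ?mulr0//; exact: integrableR_bounded_orthonormal.
rewrite -/(c _); lra.
Qed.

End Bessel.

Lemma sqr_sum_comb (R : comPzRingType) (I : finType) (u v : I -> R) :
  (\sum_i u i * v i) ^+ 2 = \sum_i \sum_k u i * u k * (v i * v k).
Proof.
rewrite expr2 mulr_suml; apply: eq_bigr => i _.
by rewrite mulr_sumr; apply: eq_bigr => k _; rewrite mulrACA.
Qed.

(** * Estimates in an approximate Lewis basis *)

Section LewisConsequences.
Context {d : measure_display} {T : measurableType d} {R : realType}.
Variables (mu : probability T R) (p : R) (n : nat) (b : 'I_n -> T -> R).
Variables (delta : R) (A : 'M[R]_n).
Local Notation E f := (Rintegral mu setT f).
Local Notation q x := (reg b delta A x).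
Local Notation w x := (reg b delta A x `^ (p / 2 - 1)).
Hypotheses (p1 : 1 <= p) (p2 : p < 2) (n0 : (0 < n)%N) (delta0 : 0 < delta).
Hypothesis Lb : forall i, inLp mu p (b i).
Hypothesis detA : \det A != 0.
Hypothesis regA : E (fun x => q x `^ (p / 2)) <= 2 * n%:R.
Hypothesis gramA : forall i k,
  `|E (fun x => w x * gram b delta A i k x) - (i == k)%:R| <= (4 * n%:R)^-1.

Let p0 : 0 < p. Proof. exact: lt_le_trans ltr01 p1. Qed.
Let nR : (0 : R) < n%:R. Proof. by rewrite ltr0n. Qed.
Let q0 x : 0 < q x. Proof. exact: reg_gt0. Qed.
Let Iq : integrableR mu (fun x => q x `^ (p / 2)). Proof. exact: integrableR_reg. Qed.
Let mlin i : measurable_fun setT (lin b A i).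
Proof. by have [] := lin_inLp p0 Lb A i. Qed.
Let mq : measurable_fun setT (reg b delta A).
Proof. exact: (measurable_reg delta p0 Lb). Qed.
Let mpow s : measurable_fun setT (fun x => q x `^ s).
Proof. exact: (measurable_regpow delta p0 Lb). Qed.

Lemma sqr_lin_le_reg i x : lin b A i x ^+ 2 <= q x.
Proof.
apply: le_trans (sum_lin_le_reg b delta A x); rewrite (bigD1 i)//= lerDl.
by apply: sumr_ge0 => *; exact: sqr_ge0.
Qed.

Lemma integrableR_pair_lin (r : T -> R) i : inLp mu p r ->
  integrableR mu (fun x => r x * lin b A i x * w x).
Proof.
by move=> Lr; apply: integrableR_pair_weight => // x; exact: sqr_lin_le_reg.
Qed.

(** Up to a nonnegative [delta] term dropped here, the left-hand side is the quadratic form of the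
    weighted Gram matrix. Entrywise errors [1/(4n)] change that form by at most a quarter of the
    squared norm of [v]. *)
Lemma weighted_sqr_comb_le (v : 'I_n -> R) :
  E (fun x => (\sum_i v i * lin b A i x) ^+ 2 * w x) <= 2 * \sum_i v i ^+ 2.
Proof.
have Ig i k := @integrableR_wgram _ _ _ mu p n b delta delta0 n0 p0 Lb A i k detA.
pose g x := \sum_i \sum_k v i * v k * (w x * gram b delta A i k x).
have Ig' : integrableR mu g.
  by apply: integrableR_sum => i; apply: integrableR_sum => k; exact: integrableRZ.
have le_g x : (\sum_i v i * lin b A i x) ^+ 2 * w x <= g x.
  have -> : g x = (\sum_i v i * lin b A i x) ^+ 2 * w x +
      w x * (delta ^+ 2 * \sum_l (\sum_i v i * A i l) ^+ 2).
    have -> : \sum_l (\sum_i v i * A i l) ^+ 2 =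
        \sum_i \sum_k v i * v k * \sum_l A i l * A k l.
      under eq_bigr do rewrite sqr_sum_comb.
      rewrite exchange_big; apply: eq_bigr => i _ /=.
      by rewrite exchange_big; apply: eq_bigr => k _ /=; rewrite mulr_sumr.
    rewrite sqr_sum_comb !mulr_suml 2!mulr_sumr -big_split; apply: eq_bigr => i _ /=.
    rewrite !mulr_suml 2!mulr_sumr -big_split; apply: eq_bigr => k _ /=.
    rewrite /gram; ring.
  rewrite lerDl mulr_ge0 ?powR_ge0// mulr_ge0 ?sqr_ge0//.
  by apply: sumr_ge0 => *; exact: sqr_ge0.
apply: (@le_trans _ _ (E g)).
  apply: Rint_le => //; apply: (integrableR_le _ Ig') => [|x].
    apply: measurable_funM => //; apply: measurable_funX.
    by apply: measurable_sum => i; exact: measurable_funM.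
  by rewrite ger0_norm// mulr_ge0 ?sqr_ge0 ?powR_ge0.
rewrite Rint_sum; last by move=> i; apply: integrableR_sum => k; exact: integrableRZ.
apply: (@le_trans _ _ (\sum_i \sum_k (v i * v k * (i == k)%:R +
    (v i ^+ 2 + v k ^+ 2) / 2 * (4 * n%:R)^-1))).
  apply: ler_sum => i _; rewrite Rint_sum; last by move=> k; exact: integrableRZ.
  apply: ler_sum => k _; rewrite Rint_scale// -lerBlDl -mulrBr.
  apply: (le_trans (ler_norm _)); rewrite normrM ler_pM//.
  rewrite normrM -[v i ^+ 2]real_normK ?num_real// -[v k ^+ 2]real_normK ?num_real//.
  by have := sqr_ge0 (`|v i| - `|v k|); rewrite sqrrB; lra.
have -> : \sum_i \sum_k (v i * v k * (i == k)%:R +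
    (v i ^+ 2 + v k ^+ 2) / 2 * (4 * n%:R)^-1) = (1 + 4^-1) * \sum_i v i ^+ 2.
  under eq_bigr => i _ do rewrite big_split /=.
  rewrite big_split [RHS]mulrDl mul1r /=; congr (_ + _).
    apply: eq_bigr => i _; rewrite (bigD1 i)//= eqxx mulr1 -expr2 big1 ?addr0//.
    by move=> k /negbTE; rewrite eq_sym => ->; rewrite mulr0.
  transitivity ((\sum_(i < n) \sum_(k < n) (v i ^+ 2 + v k ^+ 2)) * (2^-1 * (4 * n%:R)^-1)).
    rewrite mulr_suml; apply: eq_bigr => i _; rewrite mulr_suml.
    by apply: eq_bigr => k _; rewrite mulrA.
  transitivity ((\sum_(i < n) (v i ^+ 2 *+ n + \sum_k v k ^+ 2)) * (2^-1 * (4 * n%:R)^-1)).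
    congr (_ * _); apply: eq_bigr => i _.
    by rewrite big_split /= sumr_const card_ord.
  rewrite big_split /= sumr_const card_ord sumrMnl -[(\sum_i _) *+ n]mulr_natl.
  by field; rewrite gt_eqF.
have : 0 <= \sum_i v i ^+ 2 by apply: sumr_ge0 => *; exact: sqr_ge0.
lra.
Qed.

(** With [y = q^(p/2)] the left-hand side is [y^(2 - 2/p)], of exponent in [[0, 1)]. Splitting at
    [y = n] bounds this power by an affine function of [y], so that the bound on the integral of [y]
    suffices, as Jensen's inequality would give. *)
Lemma reg_mul_weight_sqr_le x : q x * w x ^+ 2 <=
  n%:R `^ (2 - 2 / p) + n%:R `^ (1 - 2 / p) * q x `^ (p / 2).
Proof.
set y := q x `^ (p / 2); have y0 : 0 < y by exact: powR_gt0.
have -> : q x * w x ^+ 2 = y `^ (2 - 2 / p).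
  rewrite -powR_mulrn ?powR_ge0// /y -!powRrM -{1}[q x]powRr1 ?(ltW (q0 x))//.
  by rewrite -powRD_gt0//; congr (_ `^ _); field; rewrite gt_eqF.
have [yn|ny] := leP y n%:R.
  apply: ler_wpDr; first by rewrite mulr_ge0 ?powR_ge0.
  apply: ge0_ler_powR; rewrite ?nnegrE ?(ltW y0) ?(ltW nR)//.
  by rewrite subr_ge0 ler_pdivrMr//; move: p1; lra.
apply: ler_wpDl; first exact: powR_ge0.
have -> : 2 - 2 / p = (1 - 2 / p) + 1 by lra.
rewrite powRD_gt0// powRr1 ?(ltW y0)// ler_wpM2r ?(ltW y0)//.
have -> : 1 - 2 / p = - (2 / p - 1) by lra.
rewrite !powRN lef_pV2 ?posrE ?powR_gt0//.
apply: ge0_ler_powR; rewrite ?nnegrE ?(ltW y0) ?(ltW nR) ?(ltW ny)//.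
by rewrite subr_ge0 ler_pdivlMr// mul1r ltW.
Qed.

Lemma integrableR_reg_mul_weight_sqr : integrableR mu (fun x => q x * w x ^+ 2).
Proof.
have I := integrableRD (integrableR_cst mu (n%:R `^ (2 - 2 / p)))
  (integrableRZ (n%:R `^ (1 - 2 / p)) Iq).
apply: (integrableR_le _ I) => [|x].
  by apply: measurable_funM => //; exact: measurable_funX.
rewrite ger0_norm ?reg_mul_weight_sqr_le// mulr_ge0 ?sqr_ge0//.
exact: ltW.
Qed.

Lemma E_reg_mul_weight_sqr_le :
  E (fun x => q x * w x ^+ 2) <= 3 * n%:R `^ (2 - 2 / p).
Proof.
have I1 := integrableR_cst mu (n%:R `^ (2 - 2 / p)).
have I2 := integrableRZ (n%:R `^ (1 - 2 / p)) Iq.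
apply: (le_trans (Rint_le integrableR_reg_mul_weight_sqr (integrableRD I1 I2)
  reg_mul_weight_sqr_le)).
rewrite Rint_add// Rint_cst Rint_scale//.
have := ler_wpM2l (powR_ge0 n%:R (1 - 2 / p)) regA.
have -> : n%:R `^ (2 - 2 / p) = n%:R `^ (1 - 2 / p) * n%:R.
  rewrite -[X in _ = _ * X]powRr1 ?(ltW nR)// -powRD_gt0//.
  by congr (_ `^ _); lra.
lra.
Qed.

Lemma sqrt_reg_mul_weight_le x : Num.sqrt (q x) * w x <= 1 + q x `^ (p / 2).
Proof.
rewrite -powR12_sqrt ?(ltW (q0 x))// -powRD_gt0//.
have -> : 2^-1 + (p / 2 - 1) = (p - 1) / 2 by field.
have e0 : 0 <= (p - 1) / 2 by rewrite divr_ge0// subr_ge0.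
have [q1|q1] := leP (q x) 1.
  apply: ler_wpDr; first exact: powR_ge0.
  apply: (@le_trans _ _ (1 `^ ((p - 1) / 2))); last by rewrite powR1.
  by apply: ge0_ler_powR; rewrite ?nnegrE ?(ltW (q0 x)).
apply: ler_wpDl => //; apply: ler_powR; first exact: ltW.
by rewrite ler_pM2r ?invr_gt0//; move: p1; lra.
Qed.

Lemma sqnorm_mul_weight_le x : delta * Num.sqrt (sqnorm_mx A) * w x <= 1 + q x `^ (p / 2).
Proof.
apply: le_trans (sqrt_reg_mul_weight_le x); rewrite ler_wpM2r ?powR_ge0//.
rewrite -{1}[delta]ger0_norm ?(ltW delta0)// -sqrtr_sqr -sqrtrM ?sqr_ge0//.
by rewrite ler_wsqrtr// sqnorm_le_reg.
Qed.

Let sA0 : 0 < delta * Num.sqrt (sqnorm_mx A).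
Proof. by rewrite mulr_gt0// sqrtr_gt0 sqnorm_mx_gt0. Qed.

Lemma integrableR_weight : integrableR mu (fun x => w x).
Proof.
have I := integrableRZ (delta * Num.sqrt (sqnorm_mx A))^-1 (integrableRD (integrableR_cst mu 1) Iq).
apply: (integrableR_le _ I) => // x; rewrite ger0_norm ?powR_ge0//.
by rewrite ler_pdivlMl// sqnorm_mul_weight_le.
Qed.

(** The integral of [w] alone has no bound uniform in [delta]. The product does, since
    [delta |A| <= q^(1/2)] and [q^(1/2) w = q^((p-1)/2) <= 1 + q^(p/2)]. *)
Lemma sqnorm_mul_E_weight_le :
  delta * Num.sqrt (sqnorm_mx A) * E (fun x => w x) <= 1 + 2 * n%:R.
Proof.
have Iw := integrableR_weight; rewrite -Rint_scale//.
have I := integrableRD (integrableR_cst mu 1) Iq.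
apply: (le_trans (Rint_le (integrableRZ _ Iw) I sqnorm_mul_weight_le)).
by rewrite Rint_add// ?Rint_cst ?lerD2l//; exact: integrableR_cst.
Qed.

(* Recovers the coefficients of [g = \sum_i a i * lin b A i] from the pairings
   [E (g * lin b A j * w)]; the second term is the effect of the
   regularisation and vanishes with [delta]. *)
Lemma sum_sqr_coef_le (a : 'I_n -> R) :
  \sum_j a j ^+ 2 <=
  4 * (\sum_j E (fun x => (\sum_i a i * lin b A i x) * lin b A j x * w x) ^+ 2) +
  4 * (delta ^+ 2 * (1 + 2 * n%:R) ^+ 2 * \sum_l (\sum_i a i * A i l) ^+ 2).
Proof.
pose c l := \sum_i a i * A i l.
pose L j := E (fun x => (\sum_i a i * lin b A i x) * lin b A j x * w x).
pose W := E (fun x => w x).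
pose theta j := delta ^+ 2 * (\sum_l c l * A j l) * W.
pose S i k := E (fun x => w x * gram b delta A i k x).
pose D j := \sum_i a i * (S i j - (i == j)%:R).
have Ig i k := @integrableR_wgram _ _ _ mu p n b delta delta0 n0 p0 Lb A i k detA.
have Ill : forall i j, integrableR mu (fun x => lin b A i x * lin b A j x * w x).
  by move=> i j; apply: integrableR_pair_lin; exact: lin_inLp.
(* [L j + theta j] is the [j]-th entry of [a] times the weighted Gram matrix [S], where [theta]
   comes from the [delta] part of [gram]; [D] is the defect caused by [S] not being the identity. *)
have aE j : a j = L j + theta j - D j.
  have LE : L j + theta j = \sum_i a i * S i j.
    transitivity (\sum_i (a i * E (fun x => lin b A i x * lin b A j x * w x) +
       a i * (delta ^+ 2 * (\sum_l A i l * A j l) * W))).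
      rewrite big_split /=; congr (_ + _).
        rewrite /L (_ : (fun x => _) =
          fun x => \sum_i a i * (lin b A i x * lin b A j x * w x)).
          rewrite Rint_sum; last by move=> i; exact: integrableRZ.
          by apply: eq_bigr => i _; rewrite Rint_scale.
        by apply/funext => x; rewrite !mulr_suml; apply: eq_bigr => i _; ring.
      rewrite /theta /c.
      have -> : \sum_l (\sum_i a i * A i l) * A j l = \sum_i a i * \sum_l A i l * A j l.
        under eq_bigr do rewrite mulr_suml.
        rewrite exchange_big; apply: eq_bigr => i _ /=.
        by rewrite mulr_sumr; apply: eq_bigr => l _; ring.
      by rewrite mulr_sumr mulr_suml; apply: eq_bigr => i _; ring.
    apply: eq_bigr => i _; rewrite -mulrDr; congr (_ * _).
    have Iw := integrableR_weight.
    rewrite /W -Rint_scale// -Rint_add//; last exact: integrableRZ.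
    by congr (Rintegral _ _ _); apply/funext => x; rewrite /gram; ring.
  rewrite LE /D; under [X in _ - X]eq_bigr do rewrite mulrBr.
  rewrite sumrB opprB addrCA subrr addr0 (bigD1 j)//= eqxx mulr1 big1 ?addr0//.
  by move=> i /negbTE->; rewrite mulr0.
(* The Frobenius norm of [S - 1] is at most [n * (1/(4n)) = 1/4]. *)
have D2 : \sum_j D j ^+ 2 <= 16^-1 * \sum_j a j ^+ 2.
  have a20 : 0 <= \sum_j a j ^+ 2 by apply: sumr_ge0 => *; exact: sqr_ge0.
  apply: (@le_trans _ _ (\sum_(j < n) (\sum_j a j ^+ 2) * (n%:R * (4 * n%:R)^-1 ^+ 2))).
    apply: ler_sum => j _; apply: (le_trans (cauchy_schwarz_sum _ _ _)).
    rewrite ler_wpM2l//.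
    apply: (@le_trans _ _ (\sum_(i < n) (4 * n%:R)^-1 ^+ 2)).
      apply: ler_sum => i _; rewrite -real_normK ?num_real//.
      by rewrite ler_sqr ?nnegrE ?invr_ge0 ?mulr_ge0 ?(ltW nR)//; exact: gramA.
    by rewrite sumr_const card_ord [leRHS]mulr_natl.
  rewrite sumr_const card_ord -[leLHS]mulr_natl le_eqVlt; apply/orP; left; apply/eqP.
  by field; rewrite gt_eqF.
(* One factor [delta] is spent, with [|A|] and [W], on [sqnorm_mul_E_weight_le]; the other one
   survives and makes [theta] small. *)
have t2 : \sum_j theta j ^+ 2 <= delta ^+ 2 * (1 + 2 * n%:R) ^+ 2 * \sum_l c l ^+ 2.
  have c20 : 0 <= \sum_l c l ^+ 2 by apply: sumr_ge0 => *; exact: sqr_ge0.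
  have W0 : 0 <= W by apply: Rint_ge0 => x; exact: powR_ge0.
  apply: (@le_trans _ _ ((delta ^+ 2 * W) ^+ 2 * ((\sum_l c l ^+ 2) * sqnorm_mx A))).
    rewrite /sqnorm_mx !mulr_sumr; apply: ler_sum => j _.
    rewrite /theta mulrAC exprMn ler_wpM2l ?sqr_ge0//.
    exact: cauchy_schwarz_sum.
  rewrite (_ : _ * (_ * _) = delta ^+ 2 *
     (delta * Num.sqrt (sqnorm_mx A) * W) ^+ 2 * \sum_l c l ^+ 2); last first.
    by rewrite -{1}[sqnorm_mx A]sqr_sqrtr ?sqnorm_mx_ge0//; ring.
  have n20 : 0 <= 1 + 2 * n%:R :> R by rewrite addr_ge0// mulr_ge0// ltW.
  rewrite ler_wpM2r// ler_wpM2l ?sqr_ge0//.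
  by rewrite ler_sqr ?nnegrE ?sqnorm_mul_E_weight_le// mulr_ge0// ltW.
(* The [D] part is at most [3/16] of the left-hand side and is absorbed, since
   [3 / (1 - 3/16) < 4]. *)
have : \sum_j a j ^+ 2 <= 3 * (\sum_j L j ^+ 2) + 3 * (\sum_j theta j ^+ 2)
    + 3 * \sum_j D j ^+ 2.
  rewrite !mulr_sumr -!big_split; apply: ler_sum => j _ /=; rewrite aE.
  have := sqr_ge0 (L j - theta j); have := sqr_ge0 (L j + D j).
  have := sqr_ge0 (theta j + D j); rewrite !sqrrD !sqrrN; lra.
have : 0 <= \sum_j L j ^+ 2 by apply: sumr_ge0 => *; exact: sqr_ge0.
have : 0 <= \sum_j theta j ^+ 2 by apply: sumr_ge0 => *; exact: sqr_ge0.
move: D2 t2.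
change (\sum_j D j ^+ 2 <= 16^-1 * \sum_j a j ^+ 2 ->
  \sum_j theta j ^+ 2 <= delta ^+ 2 * (1 + 2 * n%:R) ^+ 2 * \sum_l c l ^+ 2 ->
  0 <= \sum_j theta j ^+ 2 -> 0 <= \sum_j L j ^+ 2 ->
  \sum_j a j ^+ 2 <= 3 * (\sum_j L j ^+ 2) + 3 * (\sum_j theta j ^+ 2)
    + 3 * \sum_j D j ^+ 2 ->
  \sum_j a j ^+ 2 <= 4 * (\sum_j L j ^+ 2) +
    4 * (delta ^+ 2 * (1 + 2 * n%:R) ^+ 2 * \sum_l c l ^+ 2)).
have : 0 <= \sum_j D j ^+ 2 by apply: sumr_ge0 => *; exact: sqr_ge0.
lra.
Qed.

End LewisConsequences.

(** * The two lower bounds for simultaneous approximation *)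

Section Core.
Context {d : measure_display} {T : measurableType d} {R : realType}.
Variables (mu : probability T R) (p K : R) (N n : nat).
Variables (f : 'I_N -> T -> R) (b : 'I_n -> T -> R) (c : 'I_N -> 'I_n -> R) (eps : R).
Local Notation E f := (Rintegral mu setT f).
Local Notation r k x := (f k x - \sum_i c k i * b i x).
Hypotheses (p1 : 1 <= p) (p2 : p < 2) (K0 : 0 < K) (n0 : (0 < n)%N) (eps0 : 0 < eps).
Hypothesis mf : forall k, measurable_fun setT (f k).
Hypothesis fK : forall k x, `|f k x| <= K.
Hypothesis of_ : forall j k, E (fun x => f j x * f k x) = (j == k)%:R.
Hypothesis Lb : forall i, inLp mu p (b i).
Hypothesis r_eps : forall k, E (fun x => `|r k x| `^ p) <= eps `^ p.

Let p0 : 0 < p. Proof. exact: lt_le_trans ltr01 p1. Qed.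
Let nR : (0 : R) < n%:R. Proof. by rewrite ltr0n. Qed.

Let Lf k : inLp mu p (f k). Proof. exact: inLp_bounded (fK k). Qed.

Let LG k : inLp mu p (fun x => \sum_i c k i * b i x).
Proof. by apply: inLp_sum => // i; exact: inLpZ. Qed.

Let Lr k : inLp mu p (fun x => r k x).
Proof.
rewrite (_ : (fun=> _) = fun x => f k x + -1 * \sum_i c k i * b i x).
  by apply: inLpD => //; exact: inLpZ.
by apply/funext => x; rewrite mulN1r.
Qed.

Let integrableR_r k : integrableR mu (fun x => `|r k x|).
Proof.
have [mr Ir] := Lr k.
apply: (integrableR_le _ (integrableRD (integrableR_cst mu 1) Ir)); first exact: measurableT_comp.
move=> x; rewrite normr_id.
have [r1|r1] := leP `|r k x| 1; first by apply: ler_wpDr => //; exact: powR_ge0.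
by apply: ler_wpDl => //; apply: le1r_powR => //; exact: ltW.
Qed.

(** Pointwise [|r| <= eps + eps^(1-p) |r|^p], by comparing [|r|] with [eps]; this stands in for
    Hölder's inequality. *)
Let E_norm_r_le k : E (fun x => `|r k x|) <= 2 * eps.
Proof.
have [mr Ir] := Lr k.
have I2 := integrableRZ (eps `^ (1 - p)) Ir.
have I1 := integrableR_cst mu eps.
have e2 : eps `^ (1 - p) * eps `^ p = eps.
  by rewrite -powRD_gt0// subrK powRr1// ltW.
apply: (@le_trans _ _ (E (fun x => eps + eps `^ (1 - p) * `|r k x| `^ p))).
  apply: Rint_le => // [|x]; first exact: integrableRD.
  have [re|re] := leP `|r k x| eps.
    by apply: ler_wpDr => //; rewrite mulr_ge0 ?powR_ge0.
  apply: ler_wpDl; first exact: ltW.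
  have r0 : 0 < `|r k x| by apply: lt_trans re.
  have -> : `|r k x| `^ p = `|r k x| * `|r k x| `^ (p - 1) by rewrite mulr_powRB1.
  rewrite mulrCA ler_peMr// -[1 - p]opprB powRN mulrC ler_pdivlMr ?powR_gt0//.
  by rewrite mul1r ge0_ler_powR ?nnegrE ?subr_ge0// ltW.
rewrite Rint_add// Rint_cst Rint_scale//.
have := ler_wpM2l (powR_ge0 eps (1 - p)) (r_eps k); rewrite e2; lra.
Qed.

Lemma Rintegral_sqr_orthonormal_comb (v : 'I_N -> R) :
  E (fun x => (\sum_i v i * f i x) ^+ 2) = \sum_i v i ^+ 2.
Proof.
have Iff := integrableR_bounded_orthonormal mu mf fK.
under eq_fun do rewrite sqr_sum_comb.
rewrite Rint_sum; last by move=> i; apply: integrableR_sum => k; apply: integrableRZ; exact: Iff.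
apply: eq_bigr => i _; rewrite Rint_sum; last by move=> k; apply: integrableRZ; exact: Iff.
rewrite (bigD1 i)//= big1 => [|k ki].
  by rewrite addr0 Rint_scale ?of_ ?eqxx ?mulr1 ?expr2//; exact: Iff.
by rewrite Rint_scale ?of_ 1?eq_sym ?(negbTE ki) ?mulr0//; exact: Iff.
Qed.

Lemma rank_lower_bound :
  N%:R - n%:R <= 9 * eps ^+ 2 * N%:R * (N%:R * K ^+ 2) `^ (2 / p - 1).
Proof.
have [N0|N0] := posnP N.
  by rewrite N0 mulr0 mul0r sub0r oppr_le0 ltW.
have NR : (0 : R) < N%:R by rewrite ltr0n.
have X0 : 0 < N%:R * K ^+ 2 by rewrite mulr_gt0// exprn_gt0.
(* [dual_bound] is used with the constant density [Q] and the functions [sg * f j]. As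
   [\sum_j f j ^+ 2 <= X], the choice [s = X^(2/p-1)] makes [Q = s X] dominate their squares, while
   its weight [Q^(p/2-1) = 1/s] restores exact orthonormality. *)
set X := N%:R * K ^+ 2 in X0 *; pose s := X `^ (2 / p - 1).
have s0 : 0 < s by exact: powR_gt0.
pose sg := Num.sqrt s; have sg2 : sg ^+ 2 = s by rewrite sqr_sqrtr// ltW.
have sg0 : 0 < sg by rewrite sqrtr_gt0.
pose Q := s * X; have Q0 : 0 < Q by exact: mulr_gt0.
have Qw : Q `^ (p / 2 - 1) = s^-1.
  have -> : Q = X `^ (2 / p).
    rewrite /Q /s -[X in _ * X]powRr1 ?(ltW X0)// -powRD_gt0//.
    by congr (_ `^ _); ring.
  rewrite -powRrM /s -powRN; congr (_ `^ _); field.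
  by rewrite gt_eqF.
pose rho k j := E (fun x => f j x * r k x).
have row k : \sum_j rho k j ^+ 2 <= 9 * eps ^+ 2 * s.
  pose phi j x := sg * f j x.
  have mphi j : measurable_fun setT (phi j) by exact: measurable_funM.
  have := @dual_bound _ _ _ mu p p1 p2 N (fun x => r k x) (fun=> Q) phi eps eps0
    (Lr k) (r_eps k) mphi (measurable_cst _) (integrableR_cst mu _) (fun=> Q0).
  have phiQ x : \sum_i phi i x ^+ 2 <= Q.
    apply: (@le_trans _ _ (\sum_(i < N) s * K ^+ 2)).
      apply: ler_sum => i _; rewrite /phi exprMn sg2 ler_pM2l//.
      by rewrite -real_normK ?num_real// ler_sqr ?nnegrE ?(ltW K0).
    by rewrite sumr_const card_ord /Q /X -[leLHS]mulr_natl mulrCA.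
  move=> /(_ phiQ).
  have Ifc (v : 'I_N -> R) : integrableR mu (fun x => (\sum_i v i * f i x) ^+ 2).
    under eq_fun do rewrite sqr_sum_comb.
    apply: integrableR_sum => i; apply: integrableR_sum => j; apply: integrableRZ.
    exact: (integrableR_bounded_orthonormal mu mf fK).
  have G (v : 'I_N -> R) :
    E (fun x => (\sum_i v i * phi i x) ^+ 2 * Q `^ (p / 2 - 1)) <= 2 * \sum_i v i ^+ 2.
    rewrite (_ : (fun x => _) = fun x => (\sum_i v i * f i x) ^+ 2).
      rewrite Rintegral_sqr_orthonormal_comb.
      have : 0 <= \sum_i v i ^+ 2 by apply: sumr_ge0 => *; exact: sqr_ge0.
      lra.
    apply/funext => x.
    have -> : \sum_i v i * phi i x = sg * \sum_i v i * f i x.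
      by rewrite mulr_sumr; apply: eq_bigr => i _; rewrite /phi mulrCA.
    by rewrite exprMn sg2 Qw mulrAC mulfV ?mul1r// gt_eqF.
  move=> /(_ G).
  suff -> : \sum_i E (fun x => r k x * phi i x * Q `^ (p / 2 - 1)) ^+ 2 =
    s^-1 * \sum_j rho k j ^+ 2 by rewrite ler_pdivrMl// [s * _]mulrC.
  rewrite mulr_sumr; apply: eq_bigr => j _.
  rewrite (_ : (fun x => _) = fun x => (sg * s^-1) * (f j x * r k x)).
    rewrite Rint_scale; last first.
      apply: integrableR_mul_bounded (fK j) _ => //.
      apply: (integrableR_le _ (integrableR_r k)) => //; first by have [] := Lr k.
    by rewrite -/(rho k j) !exprMn sg2; field; rewrite gt_eqF.
  by apply/funext => x; rewrite Qw /phi; ring.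
have Ifb j i : integrableR mu (fun x => f j x * b i x).
  apply: integrableR_mul_bounded (fK j) _ => //.
  have [mb Ib] := Lb i.
  apply: (integrableR_le mb (integrableRD (integrableR_cst mu 1) Ib)) => x.
  have [r1|r1] := leP `|b i x| 1; first by apply: ler_wpDr => //; exact: powR_ge0.
  by apply: ler_wpDl => //; apply: le1r_powR => //; exact: ltW.
(* The [f k] contribute the identity, and the approximants a product factoring through dimension
   [n]. *)
have rhoE : \matrix_(k, j) rho k j =
  1%:M - (\matrix_(k, i) c k i) *m (\matrix_(i, j) E (fun x => f j x * b i x)).
  apply/matrixP => k j; rewrite !mxE.
  have Iff := integrableR_bounded_orthonormal mu mf fK.
  rewrite -of_ /rho.
  rewrite (_ : (fun x => _) =
    fun x => f k x * f j x - \sum_i c k i * (f j x * b i x)); last first.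
    apply/funext => x; rewrite mulrBr [f j x * f k x]mulrC mulr_sumr.
    by congr (_ - _); apply: eq_bigr => i _; rewrite mulrCA.
  rewrite Rint_sub//; last by apply: integrableR_sum => i; exact: integrableRZ.
  congr (_ - _); rewrite Rint_sum; last by move=> i; exact: integrableRZ.
  by apply: eq_bigr => i _; rewrite !mxE Rint_scale.
apply: (le_trans (sqnorm_id_sub_lowrank (\matrix_(k, i) c k i)
  (\matrix_(i, j) E (fun x => f j x * b i x)))).
rewrite -rhoE /sqnorm_mx.
apply: (@le_trans _ _ (\sum_(k < N) 9 * eps ^+ 2 * s)).
  apply: ler_sum => k _; apply: le_trans (row k).
  by under eq_bigr do rewrite mxE.
rewrite sumr_const card_ord -[leLHS]mulr_natl -/s le_eqVlt; apply/orP; left.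
by apply/eqP; ring.
Qed.

Lemma lewis_lower_bound : eps <= (8 * K)^-1 ->
  N%:R ^+ 2 <= 96 * (2 * (8 * K ^+ 2) `^ (2 / p - 1)) * n%:R ^+ 2 +
    304 * (2 * (8 * K ^+ 2) `^ (2 / p - 1)) * N%:R * n%:R `^ (2 / p) * eps ^+ 2.
Proof.
(* [Gam] bounds the given coefficients before any change of basis. Hence [delta] can be fixed now so
   that the regularisation error of [sum_sqr_coef_le] is at most [4 eps^2] for every [k]. *)
move=> epsK; pose Gam := 1 + \sum_k \sum_i c k i ^+ 2.
have c2 k : \sum_i c k i ^+ 2 <= Gam.
  rewrite /Gam (bigD1 k)//= addrCA lerDl addr_ge0//.
  by apply: sumr_ge0 => *; apply: sumr_ge0 => *; exact: sqr_ge0.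
have Gam1 : 1 <= Gam.
  by rewrite lerDl; apply: sumr_ge0 => *; apply: sumr_ge0 => *; exact: sqr_ge0.
have Gam0 : 0 < Gam by exact: lt_le_trans ltr01 Gam1.
have n12 : 0 < 1 + 2 * n%:R :> R by rewrite addr_gt0// mulr_gt0.
pose delta := eps / (Gam * (1 + 2 * n%:R)).
have delta0 : 0 < delta by rewrite divr_gt0// mulr_gt0.
have eta0 : 0 < (4 * n%:R)^-1 :> R by rewrite invr_gt0 mulr_gt0.
have [A [dA regA gramA]] := approximate_lewis delta0 n0 p0 p2 Lb eta0.
pose phi := lin b A; pose q := reg b delta A; pose w x := q x `^ (p / 2 - 1).
have q0 x : 0 < q x by exact: reg_gt0.
have Iq : integrableR mu (fun x => q x `^ (p / 2)) by exact: integrableR_reg.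
have mphi i : measurable_fun setT (phi i) by have [] := lin_inLp p0 Lb A i.
have mq : measurable_fun setT q by exact: (measurable_reg delta p0 Lb).
have mw : measurable_fun setT w by exact: (measurable_regpow delta p0 Lb).
pose a k i := ((\matrix_(k, i) c k i) *m invmx A) k i.
have cE k l : \sum_i a k i * A i l = c k l.
  have uA : A \in unitmx by rewrite unitmxE unitfE.
  have := mulmxKV uA (\matrix_(k, i) c k i) => /matrixP /(_ k l).
  by rewrite mxE [RHS]mxE.
have GE k x : \sum_i c k i * b i x = \sum_i a k i * phi i x.
  rewrite /phi /lin; under [RHS]eq_bigr do rewrite mulr_sumr.
  rewrite exchange_big; apply: eq_bigr => l _ /=; rewrite -cE mulr_suml.
  by apply: eq_bigr => i _; rewrite mulrA.
pose F k j := E (fun x => f k x * phi j x * w x).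
pose L k j := E (fun x => (\sum_i a k i * phi i x) * phi j x * w x).
pose rho k j := E (fun x => r k x * phi j x * w x).
have LE k j : L k j = F k j - rho k j.
  have I1 := integrableR_pair_lin p1 p2 n0 delta0 Lb dA j (Lf k).
  have I2 := integrableR_pair_lin p1 p2 n0 delta0 Lb dA j (Lr k).
  rewrite -Rint_sub//; congr (Rintegral _ _ _); apply/funext => x.
  by rewrite -GE /w; ring.
have rho2 k : \sum_j rho k j ^+ 2 <= 9 * eps ^+ 2.
  apply: (dual_bound p1 p2 eps0 (Lr k) (r_eps k) mphi mq Iq q0) => [x|v].
    exact: sum_lin_le_reg.
  exact: weighted_sqr_comb_le.
(* [76 = 4 * 2 * 9 + 4]: the pairings of the residual give [9 eps^2], the regularisation gives
   [eps^2]. *)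
have a2 k : \sum_j a k j ^+ 2 <= 8 * \sum_j F k j ^+ 2 + 76 * eps ^+ 2.
  have cc : \sum_l (\sum_i a k i * A i l) ^+ 2 = \sum_l c k l ^+ 2.
    by apply: eq_bigr => l _; rewrite cE.
  have := sum_sqr_coef_le p1 p2 n0 delta0 Lb dA regA gramA (a k); rewrite cc => h.
  have {}h : \sum_j a k j ^+ 2 <= 4 * (\sum_j L k j ^+ 2) +
    4 * (delta ^+ 2 * (1 + 2 * n%:R) ^+ 2 * \sum_l c k l ^+ 2) := h.
  have : \sum_j L k j ^+ 2 <= 2 * \sum_j F k j ^+ 2 + 2 * \sum_j rho k j ^+ 2.
    rewrite !mulr_sumr -big_split; apply: ler_sum => j _ /=; rewrite LE.
    have := sqr_ge0 (F k j + rho k j); rewrite sqrrD sqrrB; lra.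
  have : delta ^+ 2 * (1 + 2 * n%:R) ^+ 2 * (\sum_l c k l ^+ 2) <= eps ^+ 2.
    have -> : delta ^+ 2 * (1 + 2 * n%:R) ^+ 2 = eps ^+ 2 / Gam ^+ 2.
      by rewrite /delta; field; rewrite !gt_eqF.
    rewrite -mulrA ler_piMr ?sqr_ge0// mulrC ler_pdivrMr ?exprn_gt0// mul1r.
    apply: (le_trans (c2 k)); by rewrite expr2 ler_peMr// ltW.
  by have := rho2 k; move: h; lra.
(* Bessel is applied for each [j] to [phi j * w], with the sum over [k] inside; summed over [j], the
   right-hand sides are at most the integral of [q w^2]. *)
have F2 : \sum_k \sum_j F k j ^+ 2 <= 3 * n%:R `^ (2 - 2 / p).
  have Iqw := integrableR_reg_mul_weight_sqr p1 p2 n0 delta0 Lb dA.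
  have Ipw j : integrableR mu (fun x => (phi j x * w x) ^+ 2).
    apply: (integrableR_le _ Iqw) => [|x].
      by apply: measurable_funX; exact: measurable_funM.
    rewrite ger0_norm ?sqr_ge0// exprMn ler_wpM2r ?sqr_ge0//.
    exact: sqr_lin_le_reg.
  rewrite exchange_big /=.
  apply: (@le_trans _ _ (\sum_j E (fun x => (phi j x * w x) ^+ 2))).
    apply: ler_sum => j _.
    apply: le_trans (bessel mf fK of_ (measurable_funM (mphi j) mw) (Ipw j)).
    apply: ler_sum => k _; rewrite /F.
    by rewrite (_ : (fun x => _) = fun x => f k x * (phi j x * w x))//;
      apply/funext => x; rewrite mulrA.
  rewrite -Rint_sum//; apply: le_trans (E_reg_mul_weight_sqr_le p1 p2 n0 delta0 Lb dA regA).
  apply: Rint_le => // [|x]; first exact: integrableR_sum.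
  under eq_bigr do rewrite exprMn.
  by rewrite -mulr_suml ler_wpM2r ?sqr_ge0// sum_lin_le_reg.
(* The level [Lv] satisfies [Lv^(p/2) = 8 K^2 n]. Since [q^(p/2)] has integral at most [2 n],
   Markov's inequality leaves [f k ^+ 2 <= K ^+ 2] an integral of at most [1/4] on [{q > Lv}]. *)
pose M := 8 * K ^+ 2; have M0 : 0 < M by rewrite mulr_gt0// exprn_gt0.
have Mn0 : 0 < M * n%:R by exact: mulr_gt0.
pose Lv := (M * n%:R) `^ (2 / p); have Lv0 : 0 < Lv by exact: powR_gt0.
have LvE : Lv `^ (p / 2) = M * n%:R.
  rewrite /Lv -powRrM (_ : 2 / p * (p / 2) = 1) ?powRr1 ?(ltW Mn0)//.
  by field; rewrite gt_eqF.
have LvE' : Lv `^ (1 - p / 2) = (M * n%:R) `^ (2 / p - 1).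
  by rewrite /Lv -powRrM; congr (_ `^ _); field; rewrite gt_eqF.
pose chi x : R := (q x <= Lv)%R%:R.
have mchi : measurable_fun setT chi.
  rewrite (_ : chi = \1_[set x | q x <= Lv]); last first.
    by apply/funext => x; rewrite indicE; congr ((nat_of_bool _)%:R); apply/idP/idP;
      [exact: mem_set|exact: set_mem].
  apply/measurable_indic; rewrite (_ : [set _ | _] = q @^-1` `]-oo, Lv]).
    by rewrite -[X in measurable X]setTI; exact: mq.
  by apply/seteqP; split => x /=; rewrite in_itv.
pose g j x := phi j x * chi x.
have mg j : measurable_fun setT (g j) by exact: measurable_funM.
have g2 j x : g j x ^+ 2 = phi j x ^+ 2 * chi x.
  by rewrite exprMn /chi; case: (_ <= _); rewrite ?expr1n// expr0n.
have chi_le x : q x * chi x <= Lv `^ (1 - p / 2) * q x `^ (p / 2).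
  rewrite /chi; case: (leP (q x) Lv) => qL; last by rewrite /= mulr0n mulr0 mulr_ge0 ?powR_ge0.
  rewrite /= mulr1n mulr1 -{1}[q x]powRr1 ?(ltW (q0 x))//.
  rewrite -{1}(subrK (p / 2) 1) powRD_gt0// ler_wpM2r ?powR_ge0//.
  apply: ge0_ler_powR; rewrite ?nnegrE ?(ltW (q0 x)) ?(ltW Lv0)//.
  by rewrite subr_ge0 ler_pdivrMr// mul1r ltW.
have Ig2 j : integrableR mu (fun x => g j x ^+ 2).
  apply: (integrableR_le _ (integrableRZ (Lv `^ (1 - p / 2)) Iq)) => [|x].
    exact: measurable_funX.
  rewrite ger0_norm ?sqr_ge0// g2; apply: le_trans (chi_le x).
  by rewrite ler_wpM2r ?ler0n// sqr_lin_le_reg.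
have Ifg k j : integrableR mu (fun x => f k x * g j x).
  by apply: integrableR_mul_bounded (fK k) _ => //; exact: integrableR_sqr.
pose beta k j := E (fun x => f k x * g j x).
have beta2 : \sum_k \sum_j beta k j ^+ 2 <=
    2 * (8 * K ^+ 2) `^ (2 / p - 1) * n%:R `^ (2 / p).
  rewrite exchange_big /=.
  apply: (@le_trans _ _ (\sum_j E (fun x => g j x ^+ 2))).
    by apply: ler_sum => j _; exact: bessel.
  rewrite -Rint_sum//.
  apply: (@le_trans _ _ (E (fun x => Lv `^ (1 - p / 2) * q x `^ (p / 2)))).
    apply: Rint_le => [||x]; [exact: integrableR_sum|exact: integrableRZ|].
    apply: le_trans (chi_le x); under eq_bigr do rewrite g2.
    by rewrite -mulr_suml ler_wpM2r ?ler0n// sum_lin_le_reg.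
  rewrite Rint_scale// LvE'.
  apply: (le_trans (ler_wpM2l (powR_ge0 _ _) regA)).
  rewrite powRM ?(ltW M0) ?(ltW nR)//.
  have -> : n%:R `^ (2 / p) = n%:R `^ (2 / p - 1) * n%:R.
    by rewrite -[X in _ = _ * X]powRr1 ?(ltW nR)// -powRD_gt0// subrK.
  by rewrite le_eqVlt /M; apply/orP; left; apply/eqP; ring.
(* From [1 = \int f k ^+ 2], remove [1/4] for [{q > Lv}] and [2 K eps <= 1/4] for the residual; what
   remains is the pairing of [f k] with the truncated approximant. *)
have low k : 2^-1 <= \sum_j a k j * beta k j.
  have If2 := integrableR_bounded_orthonormal mu mf fK k k.
  have I1 := integrableRZ (K ^+ 2 / (M * n%:R)) Iq.
  have I2 := integrableRZ K (integrableR_r k).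
  have I3 : integrableR mu (fun x => \sum_j a k j * (f k x * g j x)).
    by apply: integrableR_sum => j; exact: integrableRZ.
  have pt x : f k x * f k x <= K ^+ 2 / (M * n%:R) * q x `^ (p / 2) +
      (K * `|r k x| + \sum_j a k j * (f k x * g j x)).
    have t1 : 0 <= K ^+ 2 / (M * n%:R) * q x `^ (p / 2).
      by rewrite mulr_ge0 ?powR_ge0// divr_ge0 ?sqr_ge0// ltW.
    have t2 : 0 <= K * `|r k x| by rewrite mulr_ge0// ltW.
    have -> : \sum_j a k j * (f k x * g j x) = f k x * (\sum_i c k i * b i x) * chi x.
      by rewrite GE mulr_sumr mulr_suml; apply: eq_bigr => j _; rewrite /g; ring.
    rewrite /chi; case: (leP (q x) Lv) => qL.
      have h : f k x * r k x <= K * `|r k x|.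
        by apply: (le_trans (ler_norm _)); rewrite normrM ler_wpM2r.
      rewrite /= mulr1n mulr1; move: h; rewrite mulrBr; lra.
    rewrite /= mulr0n mulr0 addr0.
    have h1 : f k x * f k x <= K ^+ 2.
      by rewrite -expr2 -real_normK ?num_real// ler_sqr ?nnegrE ?(ltW K0).
    have h2 : K ^+ 2 <= K ^+ 2 / (M * n%:R) * q x `^ (p / 2).
      rewrite -mulrA ler_peMr ?sqr_ge0// mulrC ler_pdivlMr// mul1r -LvE.
      by apply: ge0_ler_powR; rewrite ?nnegrE ?(ltW Lv0) ?(ltW qL) ?(ltW (q0 x))// divr_ge0// ltW.
    lra.
  have := Rint_le If2 (integrableRD I1 (integrableRD I2 I3)) pt.
  rewrite of_ eqxx Rint_add//; last exact: integrableRD.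
  rewrite Rint_add// !Rint_scale// Rint_sum; last by move=> j; exact: integrableRZ.
  have -> : \sum_i E (fun x => a k i * (f k x * g i x)) = \sum_j a k j * beta k j.
    by apply: eq_bigr => j _; rewrite Rint_scale.
  have h1 : K ^+ 2 / (M * n%:R) * E (fun x => q x `^ (p / 2)) <= 4^-1.
    have K2 : 0 <= K ^+ 2 / (M * n%:R) by rewrite divr_ge0 ?sqr_ge0// ltW.
    apply: (le_trans (ler_wpM2l K2 regA)); rewrite le_eqVlt /M; apply/orP; left.
    by apply/eqP; field; rewrite !gt_eqF.
  have h2 : K * E (fun x => `|r k x|) <= 4^-1.
    apply: (le_trans (ler_wpM2l (ltW K0) (E_norm_r_le k))).
    have h := ler_wpM2l (ltW K0) epsK.
    have e8 : K * (8 * K)^-1 = 8^-1 by field; rewrite gt_eqF.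
    by move: h; rewrite e8; lra.
  rewrite /=; lra.
have S1 : N%:R / 2 <= \sum_k \sum_j a k j * beta k j.
  apply: (@le_trans _ _ (\sum_(k < N) 2^-1)); last exact: ler_sum.
  by rewrite sumr_const card_ord -[leRHS]mulr_natl.
set C1 := 2 * (8 * K ^+ 2) `^ (2 / p - 1) in beta2 *.
have C10 : 0 <= C1 by rewrite mulr_ge0// powR_ge0.
have CS : (N%:R / 2) ^+ 2 <=
    (\sum_k \sum_j a k j ^+ 2) * (\sum_k \sum_j beta k j ^+ 2).
  apply: (@le_trans _ _ ((\sum_k \sum_j a k j * beta k j) ^+ 2)).
    rewrite ler_sqr ?nnegrE ?divr_ge0//.
    by apply: le_trans S1; rewrite divr_ge0.
  rewrite !pair_bigA; exact: cauchy_schwarz_sum.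
have a2s : \sum_k \sum_j a k j ^+ 2 <= 24 * n%:R `^ (2 - 2 / p) + 76 * N%:R * eps ^+ 2.
  apply: (@le_trans _ _ (\sum_k (8 * \sum_j F k j ^+ 2 + 76 * eps ^+ 2))).
    exact: ler_sum.
  rewrite big_split -mulr_sumr sumr_const card_ord -[_ *+ N]mulr_natl /=.
  have := F2; lra.
have b20 : 0 <= \sum_k \sum_j beta k j ^+ 2.
  by apply: sumr_ge0 => *; apply: sumr_ge0 => *; exact: sqr_ge0.
have := le_trans CS (ler_wpM2r b20 a2s).
have B0 : 0 <= 24 * n%:R `^ (2 - 2 / p) + 76 * N%:R * eps ^+ 2.
  apply: addr_ge0; first by rewrite mulr_ge0 ?powR_ge0.
  by rewrite mulr_ge0 ?sqr_ge0// mulr_ge0.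
move=> /le_trans /(_ (ler_wpM2l B0 beta2)).
have n2 : n%:R `^ (2 - 2 / p) * n%:R `^ (2 / p) = n%:R ^+ 2.
  by rewrite -powRD_gt0// subrK powR_mulrn// ltW.
have -> : (24 * n%:R `^ (2 - 2 / p) + 76 * N%:R * eps ^+ 2) * (C1 * n%:R `^ (2 / p)) =
  24 * C1 * n%:R ^+ 2 + 76 * C1 * N%:R * n%:R `^ (2 / p) * eps ^+ 2.
  by rewrite -n2; ring.
rewrite exprMn; lra.
Qed.

End Core.

(** [c] precedes the probability space, so that it can be used on the doubled space as well.
    Assuming all residuals small, the Lewis bound forces [N] to be comparable with [n], and the rank
    bound then gives a contradiction. *)
Lemma exists_large_residual (R : realType) (p K : R) : 1 <= p -> p < 2 -> 0 < K ->
  exists c : R, 0 < c /\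
    forall (d : measure_display) (T : measurableType d) (mu : probability T R)
      (N n : nat) (f : 'I_N -> T -> R) (b : 'I_n -> T -> R) (a : 'I_N -> 'I_n -> R),
    (forall k, measurable_fun setT (f k)) -> (forall k x, `|f k x| <= K) ->
    (forall j k, \int[mu]_x (f j x * f k x) = (j == k)%:R) ->
    (forall i, inLp mu p (b i)) -> (1 <= n)%N -> (2 * n <= N)%N ->
    exists k, (c * Num.min 1 (n%:R `^ (- p^-1) * N%:R `^ 2^-1)) `^ p <=
      \int[mu]_x (`|f k x - \sum_i a k i * b i x| `^ p).
Proof.
move=> p1 p2 K0; have p0 : 0 < p by exact: lt_le_trans ltr01 p1.
pose C1 := 2 * (8 * K ^+ 2) `^ (2 / p - 1).
have C10 : 0 < C1 by rewrite mulr_gt0// powR_gt0// mulr_gt0// exprn_gt0.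
pose kap := (K ^+ 2) `^ (2 / p - 1).
have kap0 : 0 < kap by rewrite powR_gt0// exprn_gt0.
have [C2 C2E] : exists C2, C2 = 304 * C1 by exists (304 * C1).
have C20 : 0 < C2 by rewrite C2E; apply: mulr_gt0; rewrite ?ltr0n.
have [C3 C3E] : exists C3, C3 = 128 * C1 by exists (128 * C1).
have C30 : 0 < C3 by rewrite C3E; apply: mulr_gt0; rewrite ?ltr0n.
pose z := C3 `^ p^-1; have z0 : 0 < z by rewrite powR_gt0.
pose u := (4 * C2)^-1; have u0 : 0 < u by rewrite invr_gt0 mulr_gt0.
pose v := (36 * (kap * z))^-1; have v0 : 0 < v by rewrite invr_gt0 !mulr_gt0.
(* The three bounds on [c] meet [eps <= 1/(8K)], make the [eps] term of the Lewis bound at most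
   [N^2 / 4], and make the right-hand side of the rank bound at most [N / 4]. *)
pose c := Num.min (8 * K)^-1 (Num.min (Num.sqrt u) (Num.sqrt v)).
have c0 : 0 < c by rewrite !lt_min !sqrtr_gt0 u0 v0 invr_gt0 mulr_gt0.
have cK : c <= (8 * K)^-1 by rewrite ge_min lexx.
have cu : c ^+ 2 <= u.
  rewrite -[leRHS]sqr_sqrtr ?(ltW u0)// ler_sqr ?nnegrE ?sqrtr_ge0 ?(ltW c0)//.
  by rewrite !ge_min lexx !orbT.
have cv : c ^+ 2 <= v.
  rewrite -[leRHS]sqr_sqrtr ?(ltW v0)// ler_sqr ?nnegrE ?sqrtr_ge0 ?(ltW c0)//.
  by rewrite !ge_min lexx !orbT.
exists c; split=> // d T mu N n f b a mf fK of_ Lb n1 nN; apply: contrapT => nk.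
have nR : (0 : R) < n%:R by rewrite ltr0n.
have N0 : (0 < N)%N by rewrite (leq_trans _ nN)// muln_gt0.
have NR : (0 : R) < N%:R by rewrite ltr0n.
have nNR : 2 * n%:R <= N%:R :> R by rewrite -natrM ler_nat.
pose tau : R := n%:R `^ (- p^-1) * N%:R `^ 2^-1.
have tau0 : 0 < tau by rewrite /tau mulr_gt0 ?powR_gt0.
have tau2 : tau ^+ 2 = n%:R `^ (- (2 / p)) * N%:R.
  rewrite exprMn -!powR_mulrn ?powR_ge0// -!powRrM mulVf// powRr1 ?(ltW NR)//.
  by congr (_ `^ _ * _); ring.
pose eps := c * Num.min 1 tau.
have eps0 : 0 < eps by rewrite mulr_gt0// lt_min ltr01.
have epsK : eps <= (8 * K)^-1.
  by apply: le_trans cK; rewrite ler_piMr ?(ltW c0)// ge_min lexx.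
have eps2 : eps ^+ 2 <= c ^+ 2 * (n%:R `^ (- (2 / p)) * N%:R).
  rewrite -tau2 -exprMn ler_sqr ?nnegrE ?(ltW eps0) ?mulr_ge0 ?(ltW c0) ?(ltW tau0)//.
  by rewrite ler_wpM2l ?(ltW c0)// ge_min lexx orbT.
have r_eps k : \int[mu]_x (`|f k x - \sum_i a k i * b i x| `^ p) <= eps `^ p.
  by rewrite leNgt; apply/negP => h; apply: nk; exists k; exact: ltW.
have nn : n%:R `^ (2 / p) * n%:R `^ (- (2 / p)) = 1 :> R.
  by rewrite -powRD_gt0// subrr powRr0.
(* Absorbing [N^2 / 4] leaves [(3/4) N^2 <= 96 C1 n^2], whence [C3 = 128 C1]. *)
have yle : N%:R ^+ 2 <= C3 * n%:R ^+ 2.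
  have := lewis_lower_bound p1 p2 K0 n1 eps0 mf fK of_ Lb r_eps epsK.
  rewrite -/C1 -C2E => h.
  have h1 : C2 * N%:R * n%:R `^ (2 / p) * eps ^+ 2 <= 4^-1 * N%:R ^+ 2.
    have C0 : 0 <= C2 * N%:R * n%:R `^ (2 / p).
      by rewrite !mulr_ge0 ?powR_ge0// ltW.
    apply: (le_trans (ler_wpM2l C0 eps2)).
    have -> : C2 * N%:R * n%:R `^ (2 / p) * (c ^+ 2 * (n%:R `^ (- (2 / p)) * N%:R))
      = C2 * N%:R ^+ 2 * c ^+ 2 * (n%:R `^ (2 / p) * n%:R `^ (- (2 / p))) by ring.
    rewrite nn mulr1.
    have D0 : 0 <= C2 * N%:R ^+ 2 by rewrite mulr_ge0 ?sqr_ge0// ltW.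
    apply: (le_trans (ler_wpM2l D0 cu)); rewrite le_eqVlt /u; apply/orP; left.
    by apply/eqP; field; rewrite gt_eqF.
  by rewrite C3E; move: h h1; lra.
(* The loss [(N / n)^(2/p)] of the rank bound, now bounded because [N] and [n] are comparable. *)
have yz : N%:R `^ (2 / p) * n%:R `^ (- (2 / p)) <= z.
  rewrite /z mulrC powRN ler_pdivrMl ?powR_gt0// !powRrM -powRM ?powR_ge0 ?(ltW C30)//.
  rewrite !powR_mulrn ?(ltW nR) ?(ltW NR)//.
  apply: ge0_ler_powR; rewrite ?nnegrE ?invr_ge0 ?(ltW p0) ?sqr_ge0//.
    by rewrite mulr_ge0 ?sqr_ge0// ltW.
  by rewrite mulrC.
have := rank_lower_bound p1 p2 K0 n1 eps0 mf fK of_ Lb r_eps.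
apply/negP; rewrite -ltNge.
have NN : N%:R `^ (2 / p) = N%:R * N%:R `^ (2 / p - 1) :> R.
  rewrite -[X in _ = X * _]powRr1 ?(ltW NR)// -powRD_gt0//.
  by congr (_ `^ _); ring.
have h : 9 * eps ^+ 2 * N%:R * (N%:R * K ^+ 2) `^ (2 / p - 1) <= 4^-1 * N%:R.
  rewrite powRM ?(ltW NR) ?sqr_ge0// -/kap.
  apply: (@le_trans _ _ (9 * (c ^+ 2 * (n%:R `^ (- (2 / p)) * N%:R)) * N%:R *
     (N%:R `^ (2 / p - 1) * kap))).
    rewrite ler_wpM2r ?mulr_ge0 ?powR_ge0 ?(ltW kap0)// ler_wpM2r ?(ltW NR)//.
    by rewrite ler_wpM2l.
  rewrite (_ : _ * (_ * kap) =
    9 * kap * N%:R * (N%:R `^ (2 / p) * n%:R `^ (- (2 / p))) * c ^+ 2); last first.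
    by rewrite NN; ring.
  apply: (@le_trans _ _ (9 * kap * N%:R * z * v)).
    rewrite ler_pM ?sqr_ge0 ?mulr_ge0 ?powR_ge0 ?(ltW kap0) ?(ltW NR)//.
    by rewrite ler_wpM2l// !mulr_ge0 ?(ltW kap0) ?(ltW NR).
  rewrite le_eqVlt /v; apply/orP; left; apply/eqP.
  by field; rewrite !gt_eqF.
apply: (le_lt_trans h); lra.
Qed.

(** * From residuals to L_p norms and Kolmogorov widths *)

Section LpInterface.
Context {d : measure_display} {T : measurableType d} {R : realType}.
Variables (mu : probability T R) (p : R).
Hypothesis p1 : 1 <= p.

Let p0 : 0 < p. Proof. exact: lt_le_trans ltr01 p1. Qed.

Lemma Lfun_inLp (f : T -> R) : f \in Lfun mu p%:E -> inLp mu p f.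
Proof.
move=> Lf; split; last exact: Lfun_integrable.
by have := sub_Lfun_mfun Lf; rewrite inE.
Qed.

Lemma Lnorm_EFin_inLp (f : T -> R) : inLp mu p f ->
  'N[mu]_p%:E[EFin \o f]%E = ((\int[mu]_x (`|f x| `^ p)) `^ p^-1)%:E.
Proof.
move=> [mf If]; rewrite unlock /= -poweR_EFin; congr (_ `^ _)%E.
rewrite /Rintegral fineK//.
exact: integrable_fin_num.
Qed.

Lemma ae_eq_Lnorm (f g : T -> \bar R) : measurable_fun setT f -> measurable_fun setT g ->
  (\forall x \ae mu, f x = g x) -> 'N[mu]_p%:E[f]%E = 'N[mu]_p%:E[g]%E.
Proof.
move=> mf mg fg; rewrite unlock /=; congr (_ `^ _)%E.
apply: ae_eq_integral => //.
- by apply: (measurableT_comp (measurable_poweR _)); exact: measurableT_comp.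
- by apply: (measurableT_comp (measurable_poweR _)); exact: measurableT_comp.
- by apply: filterS fg => x /= ->.
Qed.

Lemma Lnorm_lt_powR (f : T -> R) (e : R) : 0 <= e -> inLp mu p f ->
  e `^ p <= \int[mu]_x (`|f x| `^ p) -> (e%:E <= 'N[mu]_p%:E[EFin \o f])%E.
Proof.
move=> e0 Lf h; rewrite Lnorm_EFin_inLp// lee_fin.
have -> : e = (e `^ p) `^ p^-1 by rewrite -powRrM mulfV ?powRr1// gt_eqF.
apply: ge0_ler_powR; rewrite ?nnegrE ?powR_ge0 ?invr_ge0 ?(ltW p0)//.
by apply: Rintegral_ge0 => x _; exact: powR_ge0.
Qed.

End LpInterface.

(** Removes subspaces and infima: if every distance to [V] were below [x], each [f k] would have an
    approximant in [V] at distance below [x], and the dimension bound supplies its coefficients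
    almost everywhere. *)
Lemma kolmogorov_width_ge {d : measure_display} {T : measurableType d} {R : realType}
    {K : fieldType} (mu : {measure set T -> \bar R}) (L : set (T -> K))
    (nrm : (T -> K) -> \bar R) (n N : nat) (f : 'I_N -> T -> K) (x : \bar R) :
  (forall (b : 'I_n -> T -> K) (g : 'I_N -> T -> K) (a : 'I_N -> 'I_n -> K),
    (forall i, L (b i)) -> (forall k, L (g k)) ->
    (forall k, \forall t \ae mu, g k t = \sum_i a k i * b i t) ->
    exists k, (x <= nrm (fun t => f k t - g k t)%R)%E) ->
  (x <= kolmogorov_width mu L nrm n f)%E.
Proof.
move=> H; apply: le_ereal_inf_tmp => _ [V [[VL _ _ _] [b [Vb spanb]]] <-].
have [[k xk]|nk] := pselect (exists k, (x <= dist nrm (f k) V)%E).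
  by apply: (le_trans xk); exact: (le_bigmax _ (fun k => dist nrm (f k) V)).
have /choice[g gP] : forall k, exists g, V g /\ (nrm (fun t => f k t - g t)%R < x)%E.
  move=> k; have : (dist nrm (f k) V < x)%E.
    by rewrite ltNge; apply/negP => h; apply: nk; exists k.
  by move=> /ereal_inf_lt[_ [g Vg <-] ?]; exists g.
have /choice[a aP] : forall k, exists a : 'I_n -> K,
    \forall t \ae mu, g k t = \sum_i a i * b i t.
  by move=> k; apply: spanb; exact: (gP k).1.
have [k] := H b g a (fun i => VL _ (Vb i)) (fun k => VL _ (gP k).1) aP.
by rewrite leNgt (gP k).2.
Qed.

(** * Essentially bounded functions and the real case *)

Section EssentiallyBounded.
Context {d : measure_display} {T : measurableType d} {R : realType}.
Variable mu : probability T R.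

Lemma ae_bounded_Lnorm (f : T -> R) (K : R) : ('N[mu]_+oo[EFin \o f] <= K%:E)%E ->
  \forall x \ae mu, `|f x| <= K.
Proof.
rewrite unlock /= probability_setT lte01 => /ess_supP.
by apply: filterS => x /=; rewrite lee_fin.
Qed.

Lemma ae_eq_Rintegral (f g : T -> R) :
  measurable_fun setT f -> measurable_fun setT g ->
  (\forall x \ae mu, f x = g x) -> \int[mu]_x f x = \int[mu]_x g x.
Proof.
move=> mf mg fg; rewrite /Rintegral; congr fine.
apply: ae_eq_integral => //; [exact/measurable_EFinP|exact/measurable_EFinP|].
by apply: filterS fg => x /= ->.
Qed.

Lemma measurable_trunc (f g : T -> R) (K : R) :
  measurable_fun setT f -> measurable_fun setT g ->
  measurable_fun setT (fun x => if g x <= K then f x else 0).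
Proof.
move=> mf mg; apply: (@measurable_fun_ifT _ _ T _ f (fun=> 0) (fun x => g x <= K)) => //.
exact: measurable_fun_ler.
Qed.

End EssentiallyBounded.

Section RealCase.
Context {d : measure_display} {T : measurableType d} {R : realType}.
Variables (mu : probability T R) (p K c : R) (n N : nat).
Hypotheses (p1 : 1 <= p) (K0 : 0 < K) (c0 : 0 <= c).
Hypothesis resid : forall (f : 'I_N -> T -> R) (b : 'I_n -> T -> R) (a : 'I_N -> 'I_n -> R),
  (forall k, measurable_fun setT (f k)) -> (forall k x, `|f k x| <= K) ->
  (forall j k, \int[mu]_x (f j x * f k x) = (j == k)%:R) ->
  (forall i, inLp mu p (b i)) ->
  exists k, c `^ p <= \int[mu]_x (`|f k x - \sum_i a k i * b i x| `^ p).

Lemma real_width_ge (f : 'I_N -> T -> R) : real_orthonormal mu f ->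
  (forall k, ('N[mu]_+oo[EFin \o f k] <= K%:E)%E) ->
  (c%:E <= real_width mu p n f)%E.
Proof.
have p0 : 0 < p by exact: lt_le_trans ltr01 p1.
move=> [Lf of_] fK; apply: kolmogorov_width_ge => b g a Lb Lg gE.
have mf k : measurable_fun setT (f k).
  by have := sub_Lfun_mfun (Lf k); rewrite inE.
(* The bound [K] holds only almost everywhere; setting [f k] to 0 where it fails gives a bound
   everywhere without changing inner products or distances. *)
pose f' k x := if `|f k x| <= K then f k x else 0.
have mf' k : measurable_fun setT (f' k).
  by apply: measurable_trunc => //; exact: measurableT_comp.
have f'K k x : `|f' k x| <= K by rewrite /f'; case: ifP => // _; rewrite normr0 ltW.
have ff' k : \forall x \ae mu, f k x = f' k x.
  by apply: filterS (ae_bounded_Lnorm (fK k)) => x /= h; rewrite /f' h.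
have of' j k : \int[mu]_x (f' j x * f' k x) = (j == k)%:R.
  rewrite -of_; apply: ae_eq_Rintegral; [exact: measurable_funM..|].
  by apply: filterS2 (ff' j) (ff' k) => x /= -> ->.
have Lb' i : inLp mu p (b i) by apply: Lfun_inLp => //; exact: Lb.
have [k ck] := resid a mf' f'K of' Lb'; exists k.
have LG : inLp mu p (fun x => f' k x - \sum_i a k i * b i x).
  rewrite (_ : (fun=> _) = fun x => f' k x + -1 * \sum_i a k i * b i x).
    apply: inLpD => //; first exact: inLp_bounded (f'K k).
    by apply: inLpZ => //; apply: inLp_sum => // i; exact: inLpZ.
  by apply/funext => x; rewrite mulN1r.
have [mg _] := Lfun_inLp p1 (Lg k).
rewrite (@ae_eq_Lnorm _ _ _ mu p _ (EFin \o (fun x => f' k x - \sum_i a k i * b i x))).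
- exact: Lnorm_lt_powR.
- by apply/measurable_EFinP; exact: measurable_funB.
- by apply/measurable_EFinP; case: LG.
- by apply: filterS2 (ff' k) (gE k) => x /= -> ->.
Qed.

End RealCase.

(** * Two copies of the probability space *)

Section Doubling.
Context {d : measure_display} {T : measurableType d} {R : realType}.
Variables (mu : probability T R).

(** Each copy has mass [1/2], so that the total stays a probability measure and the real result
    applies to it. *)
Definition doubled : probability (T * bool)%type R := (mu \x bernoulli_prob 2^-1)%E.

Definition on_copies (u v : T -> R) (tb : T * bool) : R := if tb.2 then u tb.1 else v tb.1.

Lemma measurable_on_copies (u v : T -> R) : measurable_fun setT u -> measurable_fun setT v ->
  measurable_fun setT (on_copies u v).
Proof. exact: measurable_fun_if_pair. Qed.

Lemma ge0_integral_on_copies (u v : T -> R) :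
  measurable_fun setT u -> measurable_fun setT v ->
  (forall x, 0 <= u x) -> (forall x, 0 <= v x) ->
  (\int[doubled]_z (on_copies u v z)%:E =
   2^-1%:E * (\int[mu]_x (u x)%:E + \int[mu]_x (v x)%:E))%E.
Proof.
move=> mu_ mv u0 v0.
have mg : measurable_fun setT (EFin \o on_copies u v).
  by apply/measurable_EFinP; exact: measurable_on_copies.
rewrite /doubled fubini_tonelli1//; last first.
  by move=> [x []]; rewrite /on_copies lee_fin.
rewrite /fubini_F.
transitivity (\int[mu]_x (2^-1%:E * ((u x)%:E + (v x)%:E)))%E.
  apply: eq_integral => x _; rewrite integral_bernoulli_prob.
  - rewrite /on_copies /= ge0_muleDr ?lee_fin//; congr (_ + _ * _)%E.
    by congr EFin; change (1 - 2^-1 = 2^-1 :> R); lra.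
  - by rewrite invr_ge0 invf_le1//; lra.
  - by case; rewrite /on_copies lee_fin.
rewrite ge0_integralZl//; last 2 first.
- by apply: emeasurable_funD; exact/measurable_EFinP.
- by move=> x _; rewrite adde_ge0 ?lee_fin.
by rewrite ge0_integralD// => [|||]; try (move=> *; rewrite lee_fin//);
  exact/measurable_EFinP.
Qed.

Lemma integrableR_on_copies (u v : T -> R) : integrableR mu u -> integrableR mu v ->
  integrableR doubled (on_copies u v).
Proof.
move=> Iu Iv; have mu_ := integrableR_measurable Iu; have mv := integrableR_measurable Iv.
apply/integrableP; split; first by apply/measurable_EFinP; exact: measurable_on_copies.
rewrite (_ : (fun x => _) = EFin \o on_copies (fun x => `|u x|) (fun x => `|v x|)).
  rewrite ge0_integral_on_copies//; try exact: measurableT_comp.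
  have /integrableP[_ Ju] := Iu; have /integrableP[_ Jv] := Iv.
  by rewrite lte_mul_pinfty// ?lee_fin ?invr_ge0// lte_add_pinfty.
by apply/funext => -[x []].
Qed.

Lemma Rintegral_on_copies (u v : T -> R) : integrableR mu u -> integrableR mu v ->
  \int[doubled]_z on_copies u v z = 2^-1 * (\int[mu]_x u x + \int[mu]_x v x).
Proof.
have pos (f g : T -> R) : integrableR mu f -> integrableR mu g ->
    (forall x, 0 <= f x) -> (forall x, 0 <= g x) ->
    \int[doubled]_z on_copies f g z = 2^-1 * (\int[mu]_x f x + \int[mu]_x g x).
  move=> If Ig f0 g0; have mf := integrableR_measurable If; have mg := integrableR_measurable Ig.
  rewrite /Rintegral ge0_integral_on_copies//.
  have Jf := integrable_fin_num measurableT If.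
  have Jg := integrable_fin_num measurableT Ig.
  have -> : (\int[mu]_x (f x)%:E = (fine (\int[mu]_x (f x)%:E))%:E)%E by rewrite fineK.
  have -> : (\int[mu]_x (g x)%:E = (fine (\int[mu]_x (g x)%:E))%:E)%E by rewrite fineK.
  by rewrite -EFinD -EFinM.
move=> Iu Iv.
have Au := integrable_norm Iu; have Av := integrable_norm Iv.
have nn (f : T -> R) x : 0 <= f x + `|f x|.
  by rewrite -lerBlDr sub0r lerNnormlW.
(* Write [u = (u + |u|) - |u|], a difference of nonnegative integrable functions, to reduce to the
   nonnegative case. *)
transitivity (\int[doubled]_z (on_copies (fun x => u x + `|u x|) (fun x => v x + `|v x|) z -
   on_copies (fun x => `|u x|) (fun x => `|v x|) z)).
  by congr (Rintegral _ _ _); apply/funext => -[x []]; rewrite /on_copies /= addrK.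
rewrite Rint_sub; [|by apply: integrableR_on_copies; exact: integrableRD|
  exact: integrableR_on_copies].
rewrite !pos//; try exact: integrableRD.
by rewrite !Rint_add//; lra.
Qed.

Lemma inLp_on_copies (p : R) (u v : T -> R) : inLp mu p u -> inLp mu p v ->
  inLp doubled p (on_copies u v).
Proof.
move=> [m1 Iu] [mv Iv]; split; first exact: measurable_on_copies.
rewrite (_ : (fun x => _) = on_copies (fun x => `|u x| `^ p) (fun x => `|v x| `^ p)).
  exact: integrableR_on_copies.
by apply/funext => -[x []].
Qed.

End Doubling.

(** * Reduction of the complex case to the real one *)

Section ComplexCase.
Context {d : measure_display} {T : measurableType d} {R : realType}.
Variables (mu : probability T R) (p K c : R) (n N : nat).
Local Notation Re := (@complex.Re R).
Local Notation Im := (@complex.Im R).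
Local Notation normc := (@Normc.normc R).
Hypotheses (p1 : 1 <= p) (K0 : 0 < K) (c0 : 0 <= c).
Hypothesis resid : forall (f : 'I_N -> T * bool -> R) (b : 'I_(n + n) -> T * bool -> R)
    (a : 'I_N -> 'I_(n + n) -> R),
  (forall k, measurable_fun setT (f k)) -> (forall k x, `|f k x| <= Num.sqrt 2 * K) ->
  (forall j k, \int[doubled mu]_x (f j x * f k x) = (j == k)%:R) ->
  (forall i, inLp (doubled mu) p (b i)) ->
  exists k, (Num.sqrt 2 * c) `^ p <=
    \int[doubled mu]_x (`|f k x - \sum_i a k i * b i x| `^ p).

Let p0 : 0 < p. Proof. exact: lt_le_trans ltr01 p1. Qed.

Let normcE (z : R[i]) : normc z = Num.sqrt (Re z ^+ 2 + Im z ^+ 2).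
Proof. by case: z. Qed.

Let Re_le_normc (z : R[i]) : `|Re z| <= normc z.
Proof. by rewrite normcE -sqrtr_sqr ler_wsqrtr// lerDl sqr_ge0. Qed.

Let Im_le_normc (z : R[i]) : `|Im z| <= normc z.
Proof. by rewrite normcE -sqrtr_sqr ler_wsqrtr// lerDr sqr_ge0. Qed.

Let ReD (x y : R[i]) : Re (x + y) = Re x + Re y. Proof. by case: x; case: y. Qed.
Let ImD (x y : R[i]) : Im (x + y) = Im x + Im y. Proof. by case: x; case: y. Qed.
Let ReB (x y : R[i]) : Re (x - y) = Re x - Re y. Proof. by case: x; case: y. Qed.
Let ImB (x y : R[i]) : Im (x - y) = Im x - Im y. Proof. by case: x; case: y. Qed.
Let ReM (x y : R[i]) : Re (x * y) = Re x * Re y - Im x * Im y.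
Proof. by case: x; case: y. Qed.
Let ImM (x y : R[i]) : Im (x * y) = Re x * Im y + Im x * Re y.
Proof. by case: x; case: y. Qed.
Let Re_sum (I : finType) (F : I -> R[i]) : Re (\sum_i F i) = \sum_i Re (F i).
Proof. by elim/big_ind2: _ => // x y z t <- <-; rewrite ReD. Qed.
Let Im_sum (I : finType) (F : I -> R[i]) : Im (\sum_i F i) = \sum_i Im (F i).
Proof. by elim/big_ind2: _ => // x y z t <- <-; rewrite ImD. Qed.

Let measurable_normc (f : T -> R[i]) : measurable_fun setT (Re \o f) ->
  measurable_fun setT (Im \o f) -> measurable_fun setT (normc \o f).
Proof.
move=> mR mI; rewrite (_ : _ \o _ = fun x => (Re (f x) ^+ 2 + Im (f x) ^+ 2) `^ 2^-1).
  apply: (measurableT_comp (measurable_powR _)).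
  by apply: measurable_funD; exact: measurable_funX.
by apply/funext => x /=; rewrite normcE powR12_sqrt// addr_ge0 ?sqr_ge0.
Qed.

Let inLp_normc (f : T -> R[i]) : measurable_fun setT (Re \o f) ->
  measurable_fun setT (Im \o f) -> inLp mu p (Re \o f) -> inLp mu p (Im \o f) ->
  inLp mu p (normc \o f).
Proof.
move=> mR mI [_ IR] [_ II].
have LA : inLp mu p (fun x => `|Re (f x)| + `|Im (f x)|).
  by apply: inLpD => //; split; try exact: measurableT_comp;
    under eq_fun do rewrite normr_id.
case: LA => _ IA; split; first exact: measurable_normc.
apply: (integrableR_le _ IA) => [|x]; first exact/measurable_normpowR/measurable_normc.
rewrite [`| `|_| `^ _|]ger0_norm ?powR_ge0//.
apply: ge0_ler_powR; rewrite ?nnegrE ?(ltW p0)//.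
rewrite [leRHS]ger0_norm ?addr_ge0//= normcE ger0_norm ?sqrtr_ge0//.
rewrite -[leRHS]ger0_norm ?addr_ge0// -sqrtr_sqr ler_wsqrtr// sqrrD.
rewrite !real_normK ?num_real// mulr2n.
by have := mulr_ge0 (normr_ge0 (Re (f x))) (normr_ge0 (Im (f x))); lra.
Qed.

Let inLp_ReIm (f : T -> R[i]) : complex_Lfun mu p%:E f ->
  inLp mu p (Re \o f) /\ inLp mu p (Im \o f).
Proof.
move=> [mR mI nf]; have mn := measurable_normc mR mI.
have Ln : inLp mu p (normc \o f).
  by apply: Lfun_inLp => //; rewrite inE; apply/andP; split; rewrite inE.
case: Ln => _ In; split; split=> //; (apply: (integrableR_le _ In) => [|x];
  first exact: measurable_normpowR).
- rewrite ger0_norm ?powR_ge0//; apply: ge0_ler_powR; rewrite ?nnegrE ?(ltW p0)//.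
  by apply: le_trans (ler_norm _); exact: Re_le_normc.
- rewrite ger0_norm ?powR_ge0//; apply: ge0_ler_powR; rewrite ?nnegrE ?(ltW p0)//.
  by apply: le_trans (ler_norm _); exact: Im_le_normc.
Qed.

(* A complex function becomes the real function [(Re, Im)] on [T * bool]; the
   factor [sqrt 2] compensates the weight [1/2] of each copy of [T].  A complex
   span of dimension [n] becomes the real span of the [b_i] and the [i b_i]. *)
Lemma complex_width_ge (f : 'I_N -> T -> R[i]) : complex_orthonormal mu f ->
  (forall k, (complex_Lnorm mu +oo (f k) <= K%:E)%E) ->
  (c%:E <= complex_width mu p n f)%E.
Proof.
have half (x y z : R) : x <= z -> y <= z -> 2^-1 * (x + y) <= z by lra.
move=> [Lf of_] fK; apply: kolmogorov_width_ge => b g a Lb Lg gE.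
have mRf k : measurable_fun setT (Re \o f k) by case: (Lf k).
have mIf k : measurable_fun setT (Im \o f k) by case: (Lf k).
pose f' k x := if normc (f k x) <= K then f k x else 0.
have mRf' k : measurable_fun setT (Re \o f' k).
  rewrite (_ : _ \o _ = fun x => if normc (f k x) <= K then Re (f k x) else 0).
    by apply: measurable_trunc; [exact: mRf|exact: measurable_normc].
  by apply/funext => x; rewrite /f' /=; case: ifP.
have mIf' k : measurable_fun setT (Im \o f' k).
  rewrite (_ : _ \o _ = fun x => if normc (f k x) <= K then Im (f k x) else 0).
    by apply: measurable_trunc; [exact: mIf|exact: measurable_normc].
  by apply/funext => x; rewrite /f' /=; case: ifP.
have f'K k x : normc (f' k x) <= K.
  by rewrite /f'; case: ifP => // _; rewrite Normc.normc0 ltW.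
have ff' k : \forall x \ae mu, f k x = f' k x.
  apply: filterS (ae_bounded_Lnorm (fK k)) => x /=.
  rewrite ger0_norm => [h|]; first by rewrite /f' h.
  by rewrite normcE sqrtr_ge0.
have LRf' k : inLp mu p (Re \o f' k).
  by apply: (@inLp_bounded _ _ _ _ _ _ _ K) => // x; exact: le_trans (Re_le_normc _) _.
have LIf' k : inLp mu p (Im \o f' k).
  by apply: (@inLp_bounded _ _ _ _ _ _ _ K) => // x; exact: le_trans (Im_le_normc _) _.
have bnd (u : T -> R) (v : T -> R) : measurable_fun setT u -> measurable_fun setT v ->
    (forall x, `|u x| <= K) -> (forall x, `|v x| <= K) -> integrableR mu (fun x => u x * v x).
  move=> mu_ mv uK vK; apply: integrableR_mul_bounded uK _ => //.
  by apply: (integrableR_le mv (integrableR_cst mu K)).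
have RK k x : `|(Re \o f' k) x| <= K by exact: le_trans (Re_le_normc _) _.
have IK k x : `|(Im \o f' k) x| <= K by exact: le_trans (Im_le_normc _) _.
pose s2 : R := Num.sqrt 2.
have s20 : 0 <= s2 by exact: sqrtr_ge0.
have s22 : s2 * s2 = 2 by rewrite -expr2 sqr_sqrtr.
pose F k := on_copies (fun x => s2 * Re (f' k x)) (fun x => s2 * Im (f' k x)).
have mF k : measurable_fun setT (F k).
  by apply: measurable_on_copies; apply: measurable_funM => //; [exact: mRf'|exact: mIf'].
have FK k x : `|F k x| <= s2 * K.
  by case: x => x []; rewrite /F /on_copies /= normrM (ger0_norm s20) ler_wpM2l//;
    [exact: RK|exact: IK].
have oF j k : \int[doubled mu]_x (F j x * F k x) = (j == k)%:R.
  have IR := bnd _ _ (mRf' j) (mRf' k) (RK j) (RK k).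
  have II := bnd _ _ (mIf' j) (mIf' k) (IK j) (IK k).
  rewrite (_ : (fun x => _) = on_copies (fun x => 2 * (Re (f' j x) * Re (f' k x)))
    (fun x => 2 * (Im (f' j x) * Im (f' k x)))); last first.
    by apply/funext => -[x []]; rewrite /F /on_copies /= mulrACA s22.
  rewrite Rintegral_on_copies; [|exact: integrableRZ..].
  rewrite (Rint_scale _ IR) (Rint_scale _ II) -mulrDr mulrA mulVf// mul1r -Rint_add//.
  (* Only the real part of complex orthonormality is needed: the integrand [Re (f_j conj f_k)]
     equals [Re f_j Re f_k + Im f_j Im f_k]. *)
  have /(congr1 Re) := of_ j k; rewrite /complex_integral /=.
  have -> : Re (j == k)%:R = (j == k)%:R :> R by case: (j == k).
  move=> <-; apply: ae_eq_Rintegral.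
  - by apply: measurable_funD; apply: measurable_funM;
      [exact: mRf'|exact: mRf'|exact: mIf'|exact: mIf'].
  - rewrite (_ : (fun x => _) = fun x => Re (f j x) * Re (f k x) + Im (f j x) * Im (f k x)).
      by apply: measurable_funD; apply: measurable_funM;
        [exact: mRf|exact: mRf|exact: mIf|exact: mIf].
    apply/funext => x; rewrite ReM.
    by case: (f j x) (f k x) => u v [u' v'] /=; rewrite mulrN opprK.
  - apply: filterS2 (ff' j) (ff' k) => x /= <- <-; rewrite ReM.
    by case: (f j x) (f k x) => u v [u' v'] /=; rewrite mulrN opprK.
pose B i := match fintype.split i with
  | inl i => on_copies (fun x => Re (b i x)) (fun x => Im (b i x))
  | inr i => on_copies (fun x => - 1 * Im (b i x)) (fun x => Re (b i x)) end.
have LB i : inLp (doubled mu) p (B i).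
  rewrite /B; case: (fintype.split i) => {}i; have [LR LI] := inLp_ReIm (Lb i).
    exact: inLp_on_copies.
  by apply: inLp_on_copies => //; exact: inLpZ.
pose a' k i := match fintype.split i with
  | inl i => s2 * Re (a k i) | inr i => s2 * Im (a k i) end.
have [k ck] := resid a' mF FK oF LB; exists k.
pose r x := f' k x - \sum_i a k i * b i x.
have LRr : inLp mu p (Re \o r).
  rewrite (_ : _ \o _ = fun x => Re (f' k x) + -1 * \sum_i (Re (a k i) * Re (b i x) +
      - Im (a k i) * Im (b i x))).
    apply: inLpD => //; first exact: LRf'.
    apply/inLpZ/inLp_sum => // i; have [LR LI] := inLp_ReIm (Lb i).
    by apply: inLpD => //; [exact: (inLpZ (Re (a k i)) LR)|exact: (inLpZ (- Im (a k i)) LI)].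
  apply/funext => x; rewrite /r /= ReB Re_sum mulN1r; congr (_ - _).
  by apply: eq_bigr => i _; rewrite ReM mulNr.
have LIr : inLp mu p (Im \o r).
  rewrite (_ : _ \o _ = fun x => Im (f' k x) + -1 * \sum_i (Re (a k i) * Im (b i x) +
      Im (a k i) * Re (b i x))).
    apply: inLpD => //; first exact: LIf'.
    apply/inLpZ/inLp_sum => // i; have [LR LI] := inLp_ReIm (Lb i).
    by apply: inLpD => //; [exact: (inLpZ (Re (a k i)) LI)|exact: (inLpZ (Im (a k i)) LR)].
  apply/funext => x; rewrite /r /= ImB Im_sum mulN1r; congr (_ - _).
  by apply: eq_bigr => i _; rewrite ImM.
have [mRr IRr] := LRr; have [mIr IIr] := LIr.
have Lr : inLp mu p (normc \o r) by exact: inLp_normc.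
have resE : (fun z => F k z - \sum_i a' k i * B i z) =
    on_copies (fun x => s2 * Re (r x)) (fun x => s2 * Im (r x)).
  apply/funext => -[x t].
  rewrite big_split_ord /=.
  under eq_bigr do rewrite /a' /B (unsplitK (inl _)).
  under [X in _ - (_ + X)]eq_bigr do rewrite /a' /B (unsplitK (inr _)).
  case: t; rewrite /F /on_copies /= /r ?ReB ?ImB ?Re_sum ?Im_sum mulrBr -big_split mulr_sumr;
    congr (_ - _); apply: eq_bigr => i _ /=; rewrite ?ReM ?ImM; ring.
(* The mass [1/2] of each copy turns the doubled integral into an average over the real and
   imaginary parts, each dominated by [normc]; the factors [s2 ^ p] cancel. *)
have key : c `^ p <= \int[mu]_x (`|(normc \o r) x| `^ p).
  have sp0 : 0 < s2 `^ p by rewrite powR_gt0// sqrtr_gt0.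
  rewrite -(ler_pM2l sp0) -powRM//; apply: (le_trans ck).
  have -> : (fun z => `|F k z - \sum_i a' k i * B i z| `^ p) =
      on_copies (fun x => s2 `^ p * `|Re (r x)| `^ p) (fun x => s2 `^ p * `|Im (r x)| `^ p).
    apply/funext => z; have /(congr1 (fun h => h z)) /= -> := resE.
    by case: z => x []; rewrite /on_copies /= normrM (ger0_norm s20) powRM.
  have [_ Ir] := Lr.
  rewrite Rintegral_on_copies; [|exact: integrableRZ..].
  rewrite (Rint_scale _ IRr) (Rint_scale _ IIr) -mulrDr mulrCA ler_wpM2l ?(ltW sp0)//.
  have le1 : \int[mu]_x (`|Re (r x)| `^ p) <= \int[mu]_x (`|(normc \o r) x| `^ p).
    apply: Rint_le => // x; apply: ge0_ler_powR; rewrite ?nnegrE ?(ltW p0)//.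
    by apply: le_trans (ler_norm _); exact: Re_le_normc.
  have le2 : \int[mu]_x (`|Im (r x)| `^ p) <= \int[mu]_x (`|(normc \o r) x| `^ p).
    apply: Rint_le => // x; apply: ge0_ler_powR; rewrite ?nnegrE ?(ltW p0)//.
    by apply: le_trans (ler_norm _); exact: Im_le_normc.
  by apply: half; [exact: le1|exact: le2].
have := Lnorm_lt_powR p1 c0 Lr key; rewrite /complex_Lnorm.
rewrite (@ae_eq_Lnorm _ _ _ mu p _ (EFin \o normc \o (fun x => f k x - g k x)))//.
- by apply/measurable_EFinP; case: Lr.
- apply/measurable_EFinP; have [[mRg _] [mIg _]] := inLp_ReIm (Lg k).
  apply: (measurable_normc (f := fun x => f k x - g k x)).
    rewrite (_ : _ \o _ = (Re \o f k) \- (Re \o g k)); first exact: measurable_funB.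
    by apply/funext => x /=; rewrite ReB.
  rewrite (_ : _ \o _ = (Im \o f k) \- (Im \o g k)); first exact: measurable_funB.
  by apply/funext => x /=; rewrite ImB.
- by apply: filterS2 (ff' k) (gE k) => x /= -> ->.
Qed.

End ComplexCase.

Theorem theorem1p1 (R : realType) (p K : R) (hp1 : 1 <= p) (hp2 : p < 2)
    (hK : 0 < K) :
  exists c : R, 0 < c /\
    forall (d : measure_display) (T : measurableType d) (mu : probability T R)
           (N : nat),
      (forall f : 'I_N -> T -> R,
         real_orthonormal mu f ->
         (forall k, ('N[mu]_+oo[EFin \o f k] <= K%:E)%E) ->
         forall n : nat, (1 <= n)%N -> (2 * n <= N)%N ->
           ((c * Num.min 1 (n%:R `^ (- p^-1) * N%:R `^ 2^-1))%:E
              <= real_width mu p n f)%E) /\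
      (forall f : 'I_N -> T -> R[i],
         complex_orthonormal mu f ->
         (forall k, (complex_Lnorm mu +oo (f k) <= K%:E)%E) ->
         forall n : nat, (1 <= n)%N -> (4 * n <= N)%N ->
           ((c * Num.min 1 (n%:R `^ (- p^-1) * N%:R `^ 2^-1))%:E
              <= complex_width mu p n f)%E).
Proof.
have p0 : 0 < p by exact: lt_le_trans ltr01 hp1.
have s20 : 0 < Num.sqrt 2 :> R by rewrite sqrtr_gt0.
have s22 : Num.sqrt 2 <= 2 :> R.
  by rewrite -[leRHS]ger0_norm// -sqrtr_sqr ler_wsqrtr// expr2; lra.
have [c1 [c10 H1]] := exists_large_residual hp1 hp2 hK.
have [c2 [c20 H2]] := exists_large_residual hp1 hp2 (mulr_gt0 s20 hK).
(* In the complex case one factor 2 pays for [Num.sqrt 2], the other for replacing [n] by [n + n] in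
   the minimum. *)
pose c := Num.min c1 (c2 / 4).
have c0 : 0 < c by rewrite lt_min c10 divr_gt0.
exists c; split=> // d T mu N; split=> f of_ fK n n1 nN;
  set m := Num.min 1 _; have m0 : 0 <= m by rewrite le_min ler01 mulr_ge0 ?powR_ge0.
  apply: (@real_width_ge _ _ _ mu p K) => //; first by rewrite mulr_ge0// ltW.
  move=> f' b a mf' f'K of' Lb.
  have [k hk] := H1 _ _ mu N n f' b a mf' f'K of' Lb n1 nN; exists k.
  apply: le_trans hk; apply: ge0_ler_powR;
    rewrite ?nnegrE ?(ltW p0) ?mulr_ge0 ?(ltW c0) ?(ltW c10)//.
  by rewrite ler_wpM2r// ge_min lexx.
apply: (@complex_width_ge _ _ _ mu p K) => //; first by rewrite mulr_ge0// ltW.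
move=> f' b a mf' f'K of' Lb.
have nn1 : (1 <= n + n)%N by rewrite addn_gt0 n1.
have nnN : (2 * (n + n) <= N)%N by rewrite addnn -mul2n mulnA.
have [k hk] := H2 _ _ (doubled mu) N (n + n)%N f' b a mf' f'K of' Lb nn1 nnN; exists k.
have l0 : 0 <= Num.sqrt 2 * (c * m).
  by apply: mulr_ge0; [exact: ltW|apply: mulr_ge0 => //; exact: ltW].
have r0 : 0 <= c2 * Num.min 1 ((n + n)%:R `^ (- p^-1) * N%:R `^ 2^-1).
  by apply: mulr_ge0; [exact: ltW|rewrite le_min ler01 mulr_ge0 ?powR_ge0].
apply: le_trans hk; apply: ge0_ler_powR; rewrite ?nnegrE ?(ltW p0)//.
(* As [p >= 1], doubling [n] divides [n^(-1/p)] by [2^(1/p) <= 2]. *)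
have m2 : m / 2 <= Num.min 1 ((n + n)%:R `^ (- p^-1) * N%:R `^ 2^-1).
  rewrite le_min; apply/andP; split.
    have : m <= 1 by rewrite ge_min lexx.
    lra.
  have mle : m <= n%:R `^ (- p^-1) * N%:R `^ 2^-1 by rewrite ge_min lexx orbT.
  rewrite ler_pdivrMr//; apply: (le_trans mle); rewrite mulrAC ler_wpM2r ?powR_ge0//.
  rewrite addnn -mul2n natrM powRM// mulrAC ler_peMl ?powR_ge0//.
  rewrite powRN mulrC ler_pdivlMr ?powR_gt0// mul1r.
  rewrite -[leRHS]powRr1//; apply: ler_powR; first by lra.
  by rewrite invf_le1.
apply: (@le_trans _ _ (2 * (c2 / 4 * m))).
  apply: ler_pM => //; rewrite ?mulr_ge0 ?(ltW s20) ?(ltW c0)//.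
  by rewrite ler_wpM2r// ge_min lexx orbT.
have := ler_wpM2l (ltW c20) m2; lra.
Qed.
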